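(* Let $r\ge2$, let $n$ be sufficiently large, and let $\mathcal{H}$ be a finite graph family satisfying $\chi(\mathcal{H})=r+1\ge3$ and ${\rm ex}(n,\mathcal{H})<e(T_{n,r})+\lfloor\frac{n}{2r}\rfloor$. Then ${\rm SPEX}(n,\mathcal{H})\subseteq{\rm EX}(n,\mathcal{H})$.
   Context: All graphs are finite and simple. A graph family $\mathcal{H}$ is finite if $|H|$ is bounded above by a fixed constant for all $H\in\mathcal{H}$; $\chi(\mathcal{H})=\min\{\chi(H):H\in\mathcal{H}\}$. A graph is $\mathcal{H}$-free if it contains no member of $\mathcal{H}$ as a subgraph. ${\rm ex}(n,\mathcal{H})$ is the maximum number of edges of an $n$-vertex $\mathcal{H}$-free graph and ${\rm EX}(n,\mathcal{H})$ the set of $n$-vertex $\mathcal{H}$-free graphs attaining it. $\rho(G)$ is the spectral radius of the adjacency matrix of $G$; ${\rm spex}(n,\mathcal{H})$ is the maximum of $\rho(G)$ over $n$-vertex $\mathcal{H}$-free graphs $G$, and ${\rm SPEX}(n,\mathcal{H})$ is the set of $n$-vertex $\mathcal{H}$-free graphs $G$ with $\rho(G)={\rm spex}(n,\mathcal{H})$. $T_{n,r}$ is the $r$-partite Turán graph on $n$ vertices. *)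

(* Defs.v *)
From HB Require Import structures.
From mathcomp Require Import all_boot all_order all_algebra.
From mathcomp Require Import boolp classical_sets reals.
From mathcomp Require Import complex.

Set Implicit Arguments.
Unset Strict Implicit.
Unset Printing Implicit Defensive.

Import Order.TTheory GRing.Theory Num.Theory.

Local Open Scope nat_scope.

Record sgraph (n : nat) := SGraph {
  edges : {set {set 'I_n}};
  edges_card2 : [forall e in edges, #|e| == 2] }.

HB.instance Definition _ n := [isSub for @edges n].
HB.instance Definition _ n := [Finite of sgraph n by <:].

Definition adj n (G : sgraph n) : rel 'I_n := fun x y => [set x; y]%SET \in edges G.

Definition num_edges n (G : sgraph n) : nat := #|edges G|.

(* Subgraph containment, not necessarily induced. *)
Definition contains n k (G : sgraph n) (H : sgraph k) : Prop :=
  exists f : 'I_k -> 'I_n,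
    injective f /\ forall x y, adj H x y -> adj G (f x) (f y).

Definition colorable k (H : sgraph k) (c : nat) : bool :=
  [exists f : {ffun 'I_k -> 'I_c},
    [forall x, forall y, adj H x y ==> (f x != f y)]].

Lemma adj_neq n (G : sgraph n) x y : adj G x y -> x != y.
Proof.
move=> Gxy; have /forall_inP/(_ _ Gxy) := edges_card2 G.
by rewrite cards2; case: (x != y).
Qed.

Lemma colorable_order k (H : sgraph k) : exists c, colorable H c.
Proof.
exists k; apply/existsP; exists [ffun x => x].
apply/forallP => x; apply/forallP => y; apply/implyP => /adj_neq.
by rewrite !ffunE.
Qed.

Definition chromatic_number k (H : sgraph k) : nat := ex_minn (colorable_order H).

(* Every finite graph is isomorphic to one on some 'I_k, and H-freeness only
   depends on isomorphism types, so members are taken on the vertex sets 'I_k. *)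
Definition graph_family := forall k, set (sgraph k).

Definition order_bounded (F : graph_family) (m : nat) : Prop :=
  forall k (H : sgraph k), F k H -> k <= m.

(* c is the minimum of the chromatic numbers of the members of F;
   in particular F has a member. *)
Definition is_family_chromatic_number (F : graph_family) (c : nat) : Prop :=
  (exists k (H : sgraph k), F k H /\ chromatic_number H = c) /\
  (forall k (H : sgraph k), F k H -> c <= chromatic_number H).

Definition family_free (F : graph_family) n (G : sgraph n) : Prop :=
  forall k (H : sgraph k), F k H -> ~ contains G H.

Definition ex (n : nat) (F : graph_family) : nat :=
  \max_(G : sgraph n | `[< family_free F G >]) num_edges G.

Definition EX (n : nat) (F : graph_family) : set (sgraph n) :=
  [set G | family_free F G /\ num_edges G = ex n F].
Arguments EX n F : clear implicits.

(* The parts are the residue classes modulo r of the vertices 0, ..., n-1,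
   whose sizes differ by at most one. *)
Definition turan_edges (n r : nat) : {set {set 'I_n}} :=
  [set [set p.1; p.2] | p : 'I_n * 'I_n & p.1 %% r != p.2 %% r]%SET.

Lemma turan_edges_card2 n r : [forall e in turan_edges n r, #|e| == 2].
Proof.
apply/forall_inP => e /imsetP[[x y] /=]; rewrite inE /= => nxy ->.
by rewrite cards2 (contraNneq _ nxy) // => ->.
Qed.

Definition turan_graph (n r : nat) : sgraph n := SGraph (turan_edges_card2 n r).

Local Open Scope ring_scope.

Definition adjacency_matrix (K : pzRingType) n (G : sgraph n) : 'M[K]_n :=
  \matrix_(x, y) (adj G x y)%:R.

Definition spectral_radius (R : realType) n (A : 'M[R[i]]_n) : R :=
  sup [set Normc.normc l | l in [set l : R[i] | eigenvalue A l]]%classic.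

Definition rho (R : realType) n (G : sgraph n) : R :=
  spectral_radius (adjacency_matrix R[i] G).

(* Starting the maximum at 0 is harmless because spectral radii are
   nonnegative. *)
Definition spex (R : realType) (n : nat) (F : graph_family) : R :=
  \big[Num.max/0]_(G : sgraph n | `[< family_free F G >]) rho R G.

Definition SPEX (R : realType) (n : nat) (F : graph_family) : set (sgraph n) :=
  [set G | family_free F G /\ rho R G = spex R n F].
Arguments SPEX R n F : clear implicits.

(* Main.v *)
From HB Require Import structures.
Require Import Defs.
From mathcomp Require Import boolp classical_sets reals.
From mathcomp Require Import complex spectral.
From mathcomp Require Import all_boot all_order all_algebra.
From mathcomp Require Import ring lra zify.

(* Put theta = 1 - 1/r. The Turan graph T with a star or a matching added inside
   one part has at least e(T) + n/2r edges, hence contains a member of F. So an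
   F-free graph has no complete r-partite piece with a large star or a large
   matching inside a part; near T, its parts carry only O(1) edges.

   Let G be F-free of maximal spectral radius rho. The all-ones vector on an
   edge-extremal graph gives n rho >= 2 ex(n, F) >= 2 e(T) >= theta n^2 - r.
   Deleting a vertex of smallest Perron weight while some degree is below
   (theta - eps) n raises rho - theta n by a constant each time, which is
   impossible unless there is no such vertex, because a graph close to a Turan
   graph has rho <= theta n + O(1/n). Thus G has large minimum degree, and it is
   the complete r-partite graph on some parts n_1, ..., n_r with a = O(1) edges
   added and b = O(1) edges removed. Its Perron vector is nearly constant, so

     n rho <= 2 e(G) + (1/r + o(1)) Q + o(1),   Q = sum (n_i - n/r)^2.

   Vertices meeting no added or removed edge can be moved between parts without
   creating a member of F. Moving g/2 of them from a largest to a smallest part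
   (g being the difference of the sizes) yields
   2 ex(n, F) >= 2 e(G) + 2 (g/2)(g - g/2), while Q <= r g^2/4; comparing,
   g <= 1, and then 2 ex(n, F) < 2 e(G) + 2. *)

Set Implicit Arguments.
Unset Strict Implicit.
Unset Printing Implicit Defensive.
Import Order.TTheory GRing.Theory Num.Theory.

Local Open Scope nat_scope.

(** * Blow-ups in graphs of large minimum degree *)

(** The last comparison is between integers: 2 ex(n, F) - 2 e(G) has to be below 2, so every error
    must end up as a small absolute constant. Bounding the form of the unbalanced multipartite graph
    by theta n would leave all of Q, which can reach r g^2/4; the gain of about g^2/2 from moving
    vertices does not beat this for any r >= 2. The second order bound leaves only Q/r, at most
    g^2/4, and the move wins by a factor two.

    The edges inside parts are O(1) because an excluded star bounds their degrees and an excluded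
    matching gives them a bounded vertex cover. No such combinatorial bound is at hand for the
    missing edges, which structure alone limits to n/K per vertex; their number is bounded
    spectrally, from n rho >= theta n^2 - r and the near constancy of the Perron vector.

    The family acts through the freeness of the Turan graph, the exclusion of the two configurations
    and, for the moves, the bound on the orders of its members. All thresholds thus depend on [r]
    and [m] alone. *)

Definition take_set (T : finType) k (A : {set T}) : {set T} :=
  [set x in take k (enum A)].

Lemma take_set_sub (T : finType) k (A : {set T}) : take_set k A \subset A.
Proof. by apply/subsetP => x; rewrite inE => /mem_take; rewrite mem_enum. Qed.

Lemma card_take_set (T : finType) k (A : {set T}) :
  k <= #|A| -> #|take_set k A| = k.
Proof.
move=> kA; rewrite cardsE (card_uniqP _) ?size_takel -?cardE //.
exact/take_uniq/enum_uniq.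
Qed.

Lemma pigeonhole_fiber (T S : finType) (f : T -> S) (A : {set T}) (D : {set S}) t :
  (forall x, x \in A -> f x \in D) -> 0 < t -> 0 < #|D| -> #|D| * t <= #|A| ->
  exists2 y, y \in D & t <= #|[set x in A | f x == y]|.
Proof.
move=> fD t0 D0 cA.
have [/exists_inP[y yD h]|] := boolP [exists y in D, t <= #|[set x in A | f x == y]|].
  by exists y.
rewrite negb_exists_in => /forall_inP h; exfalso.
have : #|A| <= #|D| * t.-1.
  rewrite -sum1_card (partition_big f (mem D)) //= -sum_nat_const leq_sum // => y yD.
  suff -> : \sum_(x in A | f x == y) 1 = #|[set x in A | f x == y]|.
    by have := h y yD; lia.
  by rewrite -sum1_card; apply: eq_bigl => x; rewrite inE.
by move: cA; nia.
Qed.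

Section Blowups.
Variables (V : finType) (e : rel V).
Hypothesis e_sym : symmetric e.
Hypothesis e_irr : irreflexive e.

Definition nbrs v := [set w | e v w].

(** For an irreflexive [e] this forces the parts to be pairwise disjoint. The predicate [J] allows
    one index to be left open, to be filled afterwards with a prescribed set. *)
Definition complete_parts (J : pred nat) (B : nat -> {set V}) :=
  forall i j u w, J i -> J j -> i != j -> u \in B i -> w \in B j -> e u w.

(* Parts are indexed by nat, only the indices below r being meaningful. *)
Definition star_config r m := exists (B : nat -> {set V}) i v (L : {set V}),
  [/\ i < r, complete_parts (gtn r) B, forall j, j < r -> m <= #|B j|,
      v \in B i /\ L \subset B i & m <= #|L| /\ L \subset nbrs v].

Definition match_config r m := exists (B : nat -> {set V}) i (s : seq (V * V)),
  [/\ i < r, complete_parts (gtn r) B, forall j, j < r -> m <= #|B j|,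
      size s = m /\ uniq (unzip1 s ++ unzip2 s) &
      forall p, p \in s -> [/\ p.1 \in B i, p.2 \in B i & e p.1 p.2]].

Lemma sum_nonnbrs (U X : {set V}) :
  \sum_(v in U) #|X :\: nbrs v| = \sum_(b in X) #|U :\: nbrs b|.
Proof.
have cardE (A : {set V}) v : #|A :\: nbrs v| = \sum_(w in A) ~~ e v w.
  by rewrite -sum1_card big_mkcond [RHS]big_mkcond; apply: eq_bigr => w _; rewrite !inE;
    case: (w \in A); case: (e v w).
under eq_bigr do rewrite cardE.
rewrite exchange_big /=; apply: eq_bigr => b _; rewrite cardE.
by apply: eq_bigr => v _; rewrite e_sym.
Qed.

Lemma card_nonnbrs (A : {set V}) v : #|A :\: nbrs v| = #|A| - #|nbrs v :&: A|.
Proof. by rewrite cardsD setIC. Qed.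

(** Induction on the number of parts, as in the Erdos-Stone theorem: each new part costs a factor
    [4 * r] in the size of all of them. *)
Lemma blowup_exists (U : {set V}) r d T s :
  let T' := T * (4 * r) ^ r in
  0 < r -> 0 < T -> 4 * r * d < #|U| -> 4 * r * (T' * 2 ^ (r * T')) <= #|U| ->
  (forall v, v \in U -> r * #|U :\: nbrs v| <= #|U| + d) -> s <= r ->
  exists B : nat -> {set V}, complete_parts (gtn s) B /\
    forall i, i < s -> B i \subset U /\ #|B i| = T * (4 * r) ^ (r - s).
Proof.
move=> T' r0 T0 kd kc degU; elim: s => [|s IH] sr.
  by exists (fun=> set0); split=> [i|i].
have [B [Bc BU]] := IH (ltnW sr).
set T2 := T * (4 * r) ^ (r - s.+1).
have T2_gt0 : 0 < T2 by rewrite muln_gt0 T0 expn_gt0 muln_gt0 r0.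
have T1E : T * (4 * r) ^ (r - s) = 4 * r * T2.
  by rewrite /T2 -subnSK // expnS mulnCA.
have T1T' : 4 * r * T2 <= T'.
  by rewrite -T1E leq_mul2l leq_pexp2l ?leq_subr ?orbT // muln_gt0 r0.
rewrite T1E in BU.
pose BB := \bigcup_(i < s) B i.
have cBB : #|BB| <= r * T'.
  apply: leq_trans (_ : \sum_(i < s) #|B i| <= _).
    rewrite /BB; elim/big_rec2: _ => [|i m A _ IHA]; first by rewrite cards0.
    by rewrite (leq_trans (leq_card_setU _ _)) // leq_add2l.
  rewrite (eq_bigr (fun=> 4 * r * T2)); last by move=> i _; have [] := BU i (ltn_ord i).
  by rewrite sum_nat_const card_ord leq_mul // ltnW.
pose X := [set v in U | [forall i : 'I_s, T2 <= #|nbrs v :&: B i|]].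
(* If [X] is large, [T2] of its vertices have the same trace [S] on the union of the parts. They
   form the new part, and each old part shrinks to its intersection with [S]. *)
have [Xbig|Xsmall] := leqP (#|powerset BB| * T2) #|X|.
  have [] := @pigeonhole_fiber _ _ (fun v => nbrs v :&: BB) X (powerset BB) T2.
  - by move=> v _; rewrite inE subsetIr.
  - exact: T2_gt0.
  - by rewrite card_powerset expn_gt0.
  - exact: Xbig.
  move=> S _ cS.
  set C := take_set T2 [set v in X | nbrs v :&: BB == S] in cS *.
  have cC : #|C| = T2 by apply: card_take_set.
  have /card_gt0P[v vC] : 0 < #|C| by rewrite cC.
  have XP w : w \in C -> w \in X /\ nbrs w :&: BB = S.
    by move=> /(subsetP (take_set_sub _ _)); rewrite inE => /andP[-> /eqP].
  have [vX Sv] := XP v vC.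
  have cBS i : i < s -> T2 <= #|B i :&: S|.
    move=> i_s; move: vX; rewrite inE => /andP[_ /forallP/(_ (Ordinal i_s)) /= h].
    apply: leq_trans h (subset_leq_card _); apply/subsetP => w; rewrite -Sv !inE => /andP[vw wB].
    by rewrite vw wB /=; apply/bigcupP; exists (Ordinal i_s).
  have CB u w i : u \in C -> w \in B i :&: S -> e u w.
    by move=> /XP[_ <-]; rewrite !inE => /and3P[_].
  exists (fun i => if i == s then C else take_set T2 (B i :&: S)); split.
    move=> i j u w /=; rewrite !ltnS => i_s j_s ij.
    case: eqP => [is_|/eqP i_ns]; case: eqP => [js_|/eqP j_ns].
    - by rewrite is_ js_ eqxx in ij.
    - by move=> uC /(subsetP (take_set_sub _ _)); apply: CB.
    - by move=> /(subsetP (take_set_sub _ _)) uB wC; rewrite e_sym; apply: CB wC uB.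
    - move=> /(subsetP (take_set_sub _ _)); rewrite inE => /andP[ui _].
      move=> /(subsetP (take_set_sub _ _)); rewrite inE => /andP[wj _].
      by apply: (Bc i j) => //=; lia.
  move=> i i_s; case: eqP => [_|/eqP i_ns].
    split; last by [].
    by apply/subsetP => w /XP[]; rewrite inE => /andP[].
  have {}i_s : i < s by lia.
  split; last by apply: card_take_set; apply: cBS.
  apply: subset_trans (take_set_sub _ _) (subset_trans (subsetIl _ _) _).
  by have [] := BU i i_s.
(* If [X] is small, non-adjacent pairs are counted. A vertex outside [X] misses at least (4r-1) T2
   vertices of some part, while each of the 4rs T2 vertices in the parts misses at most (|U|+d)/r
   vertices of [U]. As s <= r-1, this gives (4r-1)(|U|-|X|) <= 4(r-1)(|U|+d), against 4rd < |U| and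
   4r|X| <= |U|. *)
exfalso.
have count v : v \in U :\: X -> 4 * r * T2 - T2 <= \sum_(i < s) #|B i :\: nbrs v|.
  rewrite inE => /andP[vX vU]; move: vX; rewrite inE vU /= negb_forall => /existsP[j].
  rewrite -ltnNge => h; rewrite (bigD1 j) //= -[leqLHS]addn0 leq_add //.
  by rewrite card_nonnbrs; have [_ ->] := BU j (ltn_ord j); lia.
have lb : (#|U| - #|X|) * (4 * r * T2 - T2) <= \sum_(v in U) \sum_(i < s) #|B i :\: nbrs v|.
  have XU : X \subset U by apply/subsetP => v; rewrite inE => /andP[].
  apply: leq_trans (_ : \sum_(v in U :\: X) \sum_(i < s) #|B i :\: nbrs v| <= _).
    rewrite -{1}(setIidPr XU) -cardsD -sum_nat_const; apply: leq_sum => v vUX; exact: count.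
  by rewrite [leqRHS](big_setID X) /= leq_addl.
have ub : r * \sum_(v in U) \sum_(i < s) #|B i :\: nbrs v| <= s * (4 * r * T2) * (#|U| + d).
  rewrite exchange_big /= big_distrr /= -mulnA -[X in X * _]card_ord -sum_nat_const leq_sum
    // => i _.
  have [BiU cBi] := BU i (ltn_ord i).
  rewrite sum_nonnbrs big_distrr /= -cBi -sum_nat_const leq_sum // => b bB.
  by apply: degU; apply: subsetP BiU _ bB.
have Xc : #|X| <= T' * 2 ^ (r * T').
  apply: leq_trans (ltnW Xsmall) _; rewrite card_powerset mulnC leq_mul //.
    by apply: leq_trans T1T'; rewrite -[leqLHS]mul1n leq_mul // muln_gt0 r0.
  by rewrite leq_exp2l.
move: lb ub Xc kc; set S := \sum_(v in U) _; move: (T' * _) => c.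
move: #|X| => x lb ub Xc kc.
have {lb ub} : r * ((#|U| - x) * (4 * r * T2 - T2)) <= s * (4 * r * T2) * (#|U| + d).
  by apply: leq_trans ub; rewrite leq_mul2l lb orbT.
have -> : r * ((#|U| - x) * (4 * r * T2 - T2)) = r * T2 * ((#|U| - x) * (4 * r - 1)).
  rewrite (_ : 4 * r * T2 - T2 = (4 * r - 1) * T2); last by rewrite mulnBl mul1n.
  by move: (#|U| - x) (4 * r - 1) => ? ?; lia.
have -> : s * (4 * r * T2) * (#|U| + d) = r * T2 * (4 * s * (#|U| + d)) by lia.
rewrite leq_pmul2l; first nia.
by rewrite muln_gt0 r0 T2_gt0.
Qed.
End Blowups.

(** * Stability under a minimum degree condition *)

Lemma card_bigcup_le (I T : finType) (P : {set I}) (F : I -> {set T}) c :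
  (forall i, i \in P -> #|F i| <= c) -> #|\bigcup_(i in P) F i| <= #|P| * c.
Proof.
move=> Fc; rewrite -sum_nat_const; elim/big_ind2: _ => [|A a B b Aa Bb|i /Fc//].
  by rewrite cards0.
by rewrite (leq_trans (leq_card_setU _ _)) // leq_add.
Qed.

Section Structure.
Variables (V : finType) (e : rel V).
Hypothesis e_sym : symmetric e.
Hypothesis e_irr : irreflexive e.
Local Notation nbrs := (nbrs e).
Implicit Types A S U : {set V}.

Definition common_nbrs (A S : {set V}) := [set w in A | [forall u in S, e u w]].

Lemma common_nbrs_sub A S : common_nbrs A S \subset A.
Proof. by apply/subsetP => w; rewrite inE => /andP[]. Qed.

Lemma common_nbrs_adj A S u w : u \in S -> w \in common_nbrs A S -> e u w.
Proof. by move=> uS; rewrite inE => /andP[_ /forall_inP]; apply. Qed.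

Lemma card_common_nbrs A S mu : (forall u, u \in S -> #|A :\: nbrs u| <= mu) ->
  #|A| <= #|common_nbrs A S| + #|S| * mu.
Proof.
move=> h; rewrite -(cardsID (common_nbrs A S) A) (setIidPr (common_nbrs_sub _ _)).
rewrite leq_add2l; apply: leq_trans (card_bigcup_le h); apply: subset_leq_card.
apply/subsetP => w; rewrite !inE => /andP[]; case wA: (w \in A) => //=.
rewrite negb_forall_in => /exists_inP[u uS uw] _.
by apply/bigcupP; exists u => //; rewrite !inE uw.
Qed.

(** The at most r t vertices chosen so far exclude at most r t mu vertices of the next set, so [t]
    common neighbours remain there. *)
Lemma greedy_blowup r t mu (J : pred nat) (A : nat -> {set V}) s :
  (forall i j u, J i -> J j -> i < r -> j < r -> i != j -> u \in A i -> #|A j :\: nbrs u| <= mu) ->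
  (forall j, j < r -> J j -> t + r * t * mu <= #|A j|) -> s <= r ->
  exists B : nat -> {set V}, (forall i, i < s -> J i -> B i \subset A i /\ #|B i| = t) /\
    complete_parts e (fun i => (i < s) && J i) B.
Proof.
move=> Amu At; elim: s => [|s IH] sr; first by exists (fun=> set0); split.
have [B [BA Bc]] := IH (ltnW sr).
case: (boolP (J s)) => Js; last first.
  exists B; split=> [i is1 Ji|i j u w /andP[i1 Ji] /andP[j1 Jj]].
    apply: BA => //; move: is1; rewrite ltnS leq_eqVlt => /orP[/eqP iE|//].
    by rewrite -iE Ji in Js.
  apply: Bc; rewrite ?Ji ?Jj andbT.
    by move: i1; rewrite ltnS leq_eqVlt => /orP[/eqP iE|//]; rewrite -iE Ji in Js.
  by move: j1; rewrite ltnS leq_eqVlt => /orP[/eqP iE|//]; rewrite -iE Jj in Js.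
pose S := \bigcup_(i in [set i : 'I_s | J i]) B i.
have cS : #|S| <= r * t.
  apply: leq_trans (card_bigcup_le (c := t) _) _.
    by move=> i; rewrite inE => Ji; have [_ ->] := BA i (ltn_ord i) Ji.
  rewrite leq_mul2r; apply/orP; right; apply: leq_trans (max_card _) _.
  by rewrite card_ord ltnW.
have cC : t <= #|common_nbrs (A s) S|.
  have S_mu u : u \in S -> #|A s :\: nbrs u| <= mu.
    move=> /bigcupP[j]; rewrite inE => Jj uB.
    have [/subsetP BjA _] := BA j (ltn_ord j) Jj.
    by apply: (Amu j s) => //; [apply: ltn_trans sr|rewrite ltn_eqF|apply: BjA].
  have := card_common_nbrs S_mu; have := At s sr Js.
  have : #|S| * mu <= r * t * mu by rewrite leq_mul2r cS orbT.
  by lia.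
have SB u i w : i < s -> J i -> u \in B i -> w \in common_nbrs (A s) S -> e u w.
  move=> i_s Ji uB; apply: common_nbrs_adj; apply/bigcupP.
  by exists (Ordinal i_s); rewrite ?inE.
exists (fun i => if i == s then take_set t (common_nbrs (A s) S) else B i); split.
  move=> i i_s Ji; case: eqP => [->|/eqP i_ns].
    split; last exact: card_take_set.
    exact: subset_trans (take_set_sub _ _) (common_nbrs_sub _ _).
  by apply: BA => //; lia.
move=> i j u w /andP[i_s Ji] /andP[j_s Jj] ij.
case: eqP => [is_|/eqP i_ns]; case: eqP => [js_|/eqP j_ns].
- by rewrite is_ js_ eqxx in ij.
- move=> /(subsetP (take_set_sub _ _)) uC wB; rewrite e_sym.
  by apply: SB wB uC => //; lia.
- by move=> uB /(subsetP (take_set_sub _ _)); apply: SB uB => //; lia.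
- by apply: Bc => //; rewrite ?Ji ?Jj andbT; lia.
Qed.

(** The vertex [v] joins part 0, and the whole of [B 0] serves as its leaves. *)
Lemma star_of_nbr_blowup r m (B : nat -> {set V}) v : 0 < r ->
  complete_parts e (gtn r) B ->
  (forall j, j < r -> m <= #|B j| /\ B j \subset nbrs v) -> star_config e r m.
Proof.
move=> r0 Bc Bv; exists (fun j => if j == 0 then v |: B j else B j), 0, v, (B 0).
have vB j w : j < r -> w \in B j -> e v w.
  by move=> jr; have [_ /subsetP h] := Bv j jr; move/h; rewrite inE.
split=> //.
- move=> i j u w /= ir jr ij.
  case: eqP => [i0|/eqP i0]; case: eqP => [j0|/eqP j0].
  + by rewrite i0 j0 eqxx in ij.
  + by rewrite inE => /orP[|uB wB]; [rewrite inE => /eqP -> wB; apply: (vB j)|apply: (Bc i j)].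
  + rewrite inE => uB /orP[|wB]; last by apply: (Bc i j).
    by rewrite inE => /eqP ->; rewrite e_sym; apply: (vB i).
  + exact: Bc.
- move=> j jr; have [h _] := Bv j jr; case: eqP => // _; apply: leq_trans h (subset_leq_card _).
  exact: subsetUr.
- by rewrite eqxx !inE eqxx subsetUr.
- exact: Bv.
Qed.

Lemma complete_insert r i S (B : nat -> {set V}) :
  complete_parts e (fun j => (j < r) && (j != i)) B ->
  (forall j u w, j < r -> j != i -> u \in S -> w \in B j -> e u w) ->
  complete_parts e (gtn r) (fun j => if j == i then S else B j).
Proof.
move=> Bc SB j k u w /= jr kr jk.
case: eqP => [ji|/eqP ji]; case: eqP => [ki|/eqP ki].
- by rewrite ji ki eqxx in jk.
- by apply: (SB k).
- by move=> uB wS; rewrite e_sym; apply: (SB j).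
- by apply: Bc => //; rewrite ?jr ?kr.
Qed.

(** A matching that cannot be extended has its endpoints as a vertex cover. *)
Lemma matching_or_cover (S : {set V}) t :
  (exists s : seq (V * V), [/\ size s = t, uniq (unzip1 s ++ unzip2 s) &
     forall p, p \in s -> [/\ p.1 \in S, p.2 \in S & e p.1 p.2]]) \/
  (exists2 Z : {set V}, #|Z| <= 2 * t &
     forall u v, u \in S -> v \in S -> e u v -> (u \in Z) || (v \in Z)).
Proof.
elim: t => [|t [[s [ss us sS]]|[Z cZ ZP]]]; first by left; exists [::].
- pose Z := [set x in unzip1 s ++ unzip2 s].
  have cZ : #|Z| <= 2 * t.+1.
    rewrite cardsE; apply: leq_trans (card_size _) _.
    by rewrite size_cat !size_map ss; lia.
  case: (boolP [exists u in S, exists v in S, [&& e u v, u \notin Z & v \notin Z]]); last first.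
    rewrite negb_exists_in => /forall_inP h; right; exists Z => // u v uS vS uv.
    have := h u uS; rewrite negb_exists_in => /forall_inP/(_ v vS).
    by rewrite uv /= negb_and !negbK.
  move=> /exists_inP[u uS /exists_inP[v vS /and3P[uv uZ vZ]]].
  left; exists ((u, v) :: s); split.
  + by rewrite /= ss.
  + rewrite /= cat_uniq /= mem_cat inE.
    move: uZ vZ us; rewrite !inE !mem_cat !negb_or cat_uniq =>
      /andP[u1 u2] /andP[v1 v2] /and3P[us1 us2 us3].
    have unv : u != v by apply: contraTneq uv => ->; rewrite e_irr.
    rewrite (negbTE u1) (negbTE u2) (negbTE unv) us1 us3 (negbTE v2) (negbTE v1) /= !andbT.
    exact: us2.
  + by move=> p; rewrite inE => /orP[/eqP -> //|/sS].
- right; exists Z => //; lia.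
Qed.

(** Without a matching of size [m] there is a cover of at most 2m vertices, each of degree at most
    [m]. Every edge meets it, so the degree sum outside the cover is at most the one inside, which
    is at most 2m m. *)
Lemma internal_bound (S : {set V}) m :
  (forall v, v \in S -> #|nbrs v :&: S| <= m) ->
  ~ (exists s : seq (V * V), [/\ size s = m, uniq (unzip1 s ++ unzip2 s) &
     forall p, p \in s -> [/\ p.1 \in S, p.2 \in S & e p.1 p.2]]) ->
  \sum_(v in S) #|nbrs v :&: S| <= 4 * m * m.
Proof.
move=> Sm nm; have [//|[Z0 cZ0 ZP0]] := matching_or_cover S m.
pose Z := Z0 :&: S.
have cZ : #|Z| <= 2 * m by apply: leq_trans cZ0; apply: subset_leq_card; apply: subsetIl.
have ZP u v : u \in S -> v \in S -> e u v -> (u \in Z) || (v \in Z).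
  by move=> uS vS uv; rewrite !inE uS vS !andbT; apply: ZP0.
have cE (A B : {set V}) : \sum_(v in A) #|nbrs v :&: B| = \sum_(v in A) \sum_(w in B) e v w.
  apply: eq_bigr => v _; rewrite -sum1_card big_mkcond [RHS]big_mkcond.
  by apply: eq_bigr => w _; rewrite !inE; case: (w \in B); case: (e v w).
have Zb : \sum_(v in Z) #|nbrs v :&: S| <= 2 * m * m.
  apply: leq_trans (_ : #|Z| * m <= _); last by rewrite leq_mul2r cZ orbT.
  by rewrite -sum_nat_const; apply: leq_sum => v; rewrite inE => /andP[_ /Sm].
have ZS : Z \subset S by apply: subsetIr.
rewrite (big_setID Z) /= (setIidPr ZS).
suff : \sum_(v in S :\: Z) #|nbrs v :&: S| <= 2 * m * m by lia.
apply: leq_trans Zb; rewrite !cE [leqRHS]exchange_big /=.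
rewrite [leqRHS](big_setID Z) /= (setIidPr ZS); apply: leq_trans (leq_addl _ _).
apply: leq_sum => v; rewrite inE => /andP[vZ vS].
rewrite (big_setID Z) /= (setIidPr ZS) [X in _ + X]big1 ?addn0.
  by apply: leq_sum => w _; rewrite e_sym.
move=> w; rewrite inE => /andP[wZ wS]; case vw: (e v w) => //.
by have := ZP v w vS wS vw; rewrite (negbTE vZ) (negbTE wZ).
Qed.

End Structure.

(** * From a complete blow-up to a partition of all vertices *)

Definition least_index (P : pred nat) r := find P (iota 0 r).

Lemma least_indexP (P : pred nat) r :
  (exists2 i, i < r & P i) -> least_index P r < r /\ P (least_index P r).
Proof.
move=> [i ir Pi].
have h : has P (iota 0 r) by apply/hasP; exists i; rewrite // mem_iota.
have := h; rewrite has_find size_iota => lr; split=> //.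
by have := nth_find 0 h; rewrite nth_iota.
Qed.

Section Partition.
Variables (V : finType) (e : rel V).
Hypothesis e_sym : symmetric e.
Hypothesis e_irr : irreflexive e.
Local Notation nbrs := (nbrs e).
Implicit Types A S : {set V}.

Variables (U : {set V}) (r m d t y : nat) (B : nat -> {set V}).
Hypothesis r_gt0 : 0 < r.
Hypothesis m_gt0 : 0 < m.
Hypothesis t_gt0 : 0 < t.
Hypothesis no_star : ~ star_config e r m.
Hypothesis no_match : ~ match_config e r m.
Hypothesis degU : forall v, v \in U -> r * #|U :\: nbrs v| <= #|U| + d.
Hypothesis y_large : m * #|U| + 4 * m * t * d < y.+1 * t.
Hypothesis B_complete : complete_parts e (gtn r) B.
Hypothesis B_sub : forall i, i < r -> B i \subset U.
Hypothesis B_card : forall i, i < r -> #|B i| = 4 * m * t.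

Let few v i := #|nbrs v :&: B i| < m.
Let tau v := least_index (few v) r.

(** Otherwise the neighbours of [v] in the sets [B i] are complete parts of size at least [m], all
    joined to [v], which makes a star configuration. *)
Let tauP v : tau v < r /\ #|nbrs v :&: B (tau v)| < m.
Proof.
apply: least_indexP; have [/existsP[i h]|] := boolP [exists i : 'I_r, few v i].
  by exists i.
rewrite negb_exists => /forallP h; exfalso; apply: no_star.
apply: (star_of_nbr_blowup e_sym (v := v) (B := fun i => nbrs v :&: B i)) => //.
  by move=> i j u w ir jr ij; rewrite !inE => /andP[_ uB] /andP[_ wB];
    apply: (B_complete (i := i) (j := j)).
by move=> j jr; rewrite subsetIl leqNgt; have := h (Ordinal jr).
Qed.

(** The atypical vertices: besides avoiding [B (tau v)] they miss much of another [B j]. They are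
    set aside now and placed by [p] below. *)
Let Y := [set v in U | [exists j : 'I_r, (j != tau v :> nat) && (t <= #|B j :\: nbrs v|)]].

(** Avoiding [B (tau v)] already costs every vertex 4mt - m non-adjacent pairs. This nearly exhausts
    the total of 4mt(|U|+d) allowed by the degree condition, so few vertices can afford [t] more. *)
Let card_Y : #|Y| * t <= m * #|U| + 4 * m * t * d.
Proof.
have YU : Y \subset U by apply/subsetP => v; rewrite inE => /andP[].
have lb v : v \in U -> (4 * m * t - m) + (v \in Y) * t <= \sum_(i < r) #|B i :\: nbrs v|.
  move=> vU; have [tr tm] := tauP v.
  rewrite (bigD1 (Ordinal tr)) //= leq_add //.
    by rewrite card_nonnbrs B_card //; lia.
  rewrite inE vU /=; case: existsP => [[j /andP[jt tj]]|//].
  by rewrite (bigD1 j) /= ?mul1n; [apply: leq_trans tj (leq_addr _ _)|].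
have ub : r * \sum_(v in U) \sum_(i < r) #|B i :\: nbrs v| <= r * (4 * m * t * (#|U| + d)).
  rewrite exchange_big /= big_distrr /= -[X in _ <= X * _]card_ord -sum_nat_const leq_sum // => i _.
  rewrite (sum_nonnbrs e_sym) big_distrr /= -(B_card (ltn_ord i)) -sum_nat_const leq_sum // => b bB.
  by apply: degU; apply: subsetP (B_sub (ltn_ord i)) _ bB.
rewrite leq_pmul2l // in ub.
have : \sum_(v in U) ((4 * m * t - m) + (v \in Y) * t) <= 4 * m * t * (#|U| + d).
  by apply: leq_trans ub; apply: leq_sum => v; apply: lb.
rewrite big_split /= sum_nat_const -big_distrl /= -big_mkcondr /= sum1_card.
have -> : #|[pred i in U | i \in Y]| = #|Y|.
  by apply: eq_card => v; rewrite !inE; case: (v \in U).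
by nia.
Qed.

Let card_Y_le : #|Y| <= y.
Proof. by have := leq_ltn_trans card_Y y_large; rewrite ltn_pmul2r. Qed.

Let W i := [set v in U :\: Y | tau v == i].

Let W_nonnbrs i j v : v \in W i -> j < r -> j != i -> #|B j :\: nbrs v| <= t.
Proof.
rewrite !inE => /andP[/andP[vY vU] /eqP <-] jr ji.
rewrite leqNgt; apply: contra vY => h; rewrite vU /=.
by apply/existsP; exists (Ordinal jr); rewrite ji ltnW.
Qed.

(** A star of m+1 vertices inside [W i] misses at most (m+1)t vertices of each other [B j]. Since
    [B j] has 4mt vertices, at least [m] common neighbours are left, and a star configuration
    appears. *)
Let W_deg i v : v \in W i -> #|nbrs v :&: W i| < m.
Proof.
move=> vW; have ir : i < r.
  by move: vW; rewrite inE => /andP[_ /eqP <-]; have [] := tauP v.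
rewrite ltnNge; apply/negP => h; apply: no_star.
pose L := take_set m (nbrs v :&: W i).
have cL : #|L| = m by apply: card_take_set.
have LN : L \subset nbrs v := subset_trans (take_set_sub _ _) (subsetIl _ _).
have LW : L \subset W i := subset_trans (take_set_sub _ _) (subsetIr _ _).
have vLW u : u \in v |: L -> u \in W i.
  by rewrite in_setU1 => /orP[/eqP -> //|]; apply: subsetP.
have cvL : #|v |: L| = m.+1.
  rewrite cardsU1 cL (_ : v \notin L) //; apply/negP => /(subsetP LN).
  by rewrite inE e_irr.
exists (fun j => if j == i then v |: L else common_nbrs e (B j) (v |: L)), i, v, L.
split=> //.
- apply: complete_insert => //.
    move=> j k u w /andP[jr _] /andP[kr _] jk.
    move=> /(subsetP (common_nbrs_sub _ _ _)) uB /(subsetP (common_nbrs_sub _ _ _)) wB.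
    exact: (B_complete jr kr jk).
  by move=> j u w jr ji; apply: common_nbrs_adj.
- move=> j jr; case: eqP => [_|/eqP ji]; first by rewrite cvL.
  have := card_common_nbrs (fun u uL => W_nonnbrs (vLW u uL) jr ji).
  by rewrite B_card // cvL; nia.
- by rewrite eqxx in_setU1 eqxx subsetUr.
- by rewrite cL.
Qed.

Let card_W_ub i : r * #|W i| <= #|U| + d + r * m.
Proof.
have [->|/set0Pn[v vW]] := eqVneq (W i) set0; first by rewrite cards0; lia.
have vU : v \in U by move: vW; rewrite !inE => /andP[/andP[]].
have WU : W i \subset U by apply/subsetP => w; rewrite !inE => /andP[/andP[]].
have := degU vU; have := W_deg vW.
have : #|W i| <= #|W i :&: nbrs v| + #|U :\: nbrs v|.
  by rewrite -(cardsID (nbrs v) (W i)) leq_add2l subset_leq_card // setSD.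
rewrite (setIC (W i)); move: #|_ :&: _| #|_ :\: _| #|W i| #|U| => a b c k; nia.
Qed.

(** The classes and [Y] together exhaust [U]; as [Y] and the other r-1 classes are bounded above,
    [W i] cannot be small. *)
Let card_W_lb i : i < r ->
  #|U| + d + r * m <= r * #|W i| + r * (y + d + r * m).
Proof.
move=> ir.
have sW : #|U| <= #|Y| + \sum_(j < r) #|W j|.
  have YU : Y \subset U by apply/subsetP => v; rewrite inE => /andP[].
  rewrite -(cardsID Y U) (setIidPr YU) leq_add2l -sum1_card.
  rewrite (partition_big (fun v => Ordinal (proj1 (tauP v))) predT) //=.
  apply: leq_sum => j _; rewrite -sum1_card; apply: eq_leq; apply: eq_bigl => v.
  by rewrite [in RHS]inE; congr (_ && _).
move: sW; rewrite (bigD1 (Ordinal ir)) //=.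
set S := \sum_(_ < r | _) _.
have : r * S <= (r - 1) * (#|U| + d + r * m).
  rewrite big_distrr /= (_ : r - 1 = #|[pred j | j != Ordinal ir]|).
    by rewrite -sum_nat_const leq_sum.
  by rewrite cardC1 card_ord subn1.
move: #|W i| #|U| #|Y| (r * m) S card_Y_le => w k y' rm S; nia.
Qed.

Let mu1 := y + d + r * m.

(** A vertex of [U] misses at most (|U|+d)/r vertices. If it has few neighbours in [W i], whose size
    is close to |U|/r, then [W i] uses up nearly all of this allowance. *)
Let W_out i v b : i < r -> v \in U -> #|nbrs v :&: W i| <= b ->
  #|(U :\: W i) :\: nbrs v| <= mu1 + b.
Proof.
move=> ir vU Wb; have := degU vU; have := card_W_lb ir; rewrite -/mu1.
have WU : W i \subset U by apply/subsetP => w; rewrite !inE => /andP[/andP[]].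
have -> : #|U :\: nbrs v| = #|W i :\: nbrs v| + #|(U :\: W i) :\: nbrs v|.
  by rewrite -(cardsID (W i) (U :\: nbrs v)) setIDAC (setIidPr WU) !setDDl setUC.
rewrite card_nonnbrs.
move: #|_ :&: _| #|_ :\: _| #|W i| #|U| Wb => x o w k xb h1 h2.
have {}h2 : r * (w - b + o) <= k + d by apply: leq_trans h2; rewrite leq_mul2l; lia.
have : r * w <= r * (w - b) + r * b by rewrite -mulnDr leq_mul2l; lia.
move: h1 h2; rewrite mulnDr => h1 h2 h3.
by rewrite -(leq_pmul2l r_gt0) mulnDr; lia.
Qed.

Let mu := mu1 + m.
Let beta := m + r * m * mu.
Let nu := mu1 + beta.

Hypothesis U_large : r * (m + r * m * nu + 2 * m * nu + mu1) <= #|U|.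

Let W_large j : j < r -> m + r * m * nu + 2 * m * nu <= #|W j|.
Proof.
move=> jr; rewrite -(leq_pmul2l r_gt0).
by have := card_W_lb jr; rewrite -/mu1; move: U_large; rewrite mulnDr; lia.
Qed.

Let W_sub i : W i \subset U.
Proof. by apply/subsetP => w; rewrite !inE => /andP[/andP[]]. Qed.

Let W_W i j u : i < r -> j < r -> i != j -> u \in W i -> #|W j :\: nbrs u| <= mu.
Proof.
move=> ir jr ij uW; apply: leq_trans (_ : #|(U :\: W i) :\: nbrs u| <= _).
  apply: subset_leq_card; apply: setSD; apply/subsetP => w wW.
  rewrite inE (subsetP (W_sub j)) // andbT.
  by apply: contra ij => wWi; move: wW wWi; rewrite !inE => /andP[_ /eqP ->] /andP[_];
    rewrite eq_sym.
by apply: W_out => //; [apply: subsetP (W_sub i) _ uW|apply/ltnW/W_deg].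
Qed.

Let mu_nu : mu <= nu.
Proof. by rewrite /nu /beta /mu; lia. Qed.

(** The value [beta] is what [greedy_blowup] needs to find [m] vertices per part with defect [mu]. A
    vertex with [beta] neighbours in every class would therefore be the centre of a star
    configuration, so a class with fewer exists. *)
Let p v := if v \in Y then least_index (fun i => #|nbrs v :&: W i| < beta) r else tau v.

Let pP v : v \in U -> p v < r /\ #|nbrs v :&: W (p v)| <= beta.
Proof.
move=> vU; rewrite /p; case: ifPn => vY; last first.
  have [tr _] := tauP v; split=> //.
  have /W_deg h : v \in W (tau v) by rewrite in_set in_setD vY vU eqxx.
  by rewrite (leq_trans (ltnW h)) // leq_addr.
suff /least_indexP[lr lb] : exists2 i, i < r & #|nbrs v :&: W i| < beta.
  by split=> //; apply: ltnW.
have [/existsP[i h]|] := boolP [exists i : 'I_r, #|nbrs v :&: W i| < beta].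
  by exists i.
rewrite negb_exists => /forallP h; exfalso; apply: no_star.
have [||B' [B'W B'c]] := @greedy_blowup V e e_sym r m mu predT (fun i =>
  nbrs v :&: W i) r _ _ (leqnn r).
- move=> i j u _ _ ir jr ij; rewrite inE => /andP[_ uW].
  apply: leq_trans (W_W ir jr ij uW); by apply: subset_leq_card; apply: setSD; apply: subsetIr.
- by move=> j jr _; have := h (Ordinal jr); rewrite -leqNgt.
apply: (star_of_nbr_blowup e_sym (v := v) (B := B')) => //.
  by move=> i j u w /= ir jr; apply: B'c; rewrite andbT.
move=> j jr; have [s ->] := B'W j jr isT; split=> //.
by apply: subset_trans s (subsetIl _ _).
Qed.

Let part i := [set v in U | p v == i].

Let W_part i : W i \subset part i.
Proof.
apply/subsetP => v; rewrite in_set in_setD => /andP[/andP[vY vU] /eqP <-].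
by rewrite in_set vU /p ifN //=.
Qed.

Let part_out i v : v \in part i -> #|(U :\: W i) :\: nbrs v| <= nu.
Proof.
by rewrite inE => /andP[vU /eqP <-]; have [pr pb] := pP vU; apply: W_out.
Qed.

Let part_lt i v : v \in part i -> i < r.
Proof. by rewrite inE => /andP[vU /eqP <-]; have [] := pP vU. Qed.

(** The bound 2m accommodates both a star with [m] leaves and a matching with [m] edges; the sets
    [B'] complete either one to a forbidden configuration. *)
Let blowup_around i S : i < r -> S \subset part i -> #|S| <= 2 * m ->
  exists B' : nat -> {set V},
  [/\ complete_parts e (fun j => (j < r) && (j != i)) B',
     forall j u w, j < r -> j != i -> u \in S -> w \in B' j -> e u w &
     forall j, j < r -> j != i -> #|B' j| = m].
Proof.
move=> ir Sp cS.
have [||B' [B'W B'c]] := @greedy_blowup V e e_sym r m nu (predC1 i)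
    (fun j => common_nbrs e (W j) S) r _ _ (leqnn r).
- move=> j k u _ _ jr kr jk /(subsetP (common_nbrs_sub _ _ _)) uW.
  apply: leq_trans mu_nu; apply: leq_trans (W_W jr kr jk uW).
  by apply: subset_leq_card; apply: setSD; apply: common_nbrs_sub.
- move=> j jr /= ji.
  have S_nu u : u \in S -> #|W j :\: nbrs u| <= nu.
    move=> uS; apply: leq_trans (part_out (subsetP Sp _ uS)).
    apply: subset_leq_card; apply: setSD; apply/subsetP => w wW.
    rewrite inE (subsetP (W_sub j)) // andbT.
    by apply: contra ji => wWi; move: wW wWi; rewrite !inE => /andP[_ /eqP ->] /andP[_].
  have := card_common_nbrs S_nu; have := W_large jr.
  have : #|S| * nu <= 2 * m * nu by rewrite leq_mul2r cS orbT.
  by lia.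
exists B'; split=> [//|j u w jr ji uS wB|j jr ji]; last by have [] := B'W j jr ji.
by have [/subsetP B's _] := B'W j jr ji; apply: common_nbrs_adj uS (B's _ wB).
Qed.

Let part_deg i v : v \in part i -> #|nbrs v :&: part i| < m.
Proof.
move=> vp; have ir := part_lt vp.
rewrite ltnNge; apply/negP => h; apply: no_star.
pose L := take_set m (nbrs v :&: part i).
have cL : #|L| = m by apply: card_take_set.
have LN : L \subset nbrs v := subset_trans (take_set_sub _ _) (subsetIl _ _).
have LW : L \subset part i := subset_trans (take_set_sub _ _) (subsetIr _ _).
have vLp : v |: L \subset part i by rewrite subUset sub1set vp.
have cvL : #|v |: L| = m.+1.
  rewrite cardsU1 cL (_ : v \notin L) //; apply/negP => /(subsetP LN).
  by rewrite inE e_irr.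
have [|B' [B'c B'S B'm]] := blowup_around ir vLp; first by rewrite cvL; lia.
exists (fun j => if j == i then v |: L else B' j), i, v, L; split=> //.
- exact: complete_insert.
- by move=> j jr; case: eqP => [_|/eqP ji]; rewrite ?cvL ?B'm.
- by rewrite eqxx in_setU1 eqxx subsetUr.
- by rewrite cL.
Qed.

Let part_match i : i < r -> ~ (exists s : seq (V * V),
  [/\ size s = m, uniq (unzip1 s ++ unzip2 s) &
     forall q, q \in s -> [/\ q.1 \in part i, q.2 \in part i & e q.1 q.2]]).
Proof.
move=> ir [s [ss us sp]]; apply: no_match.
pose S := [set x in unzip1 s ++ unzip2 s].
have cS : #|S| = 2 * m.
  by rewrite cardsE (card_uniqP us) size_cat !size_map ss; lia.
have Sp : S \subset part i.
  apply/subsetP => x; rewrite inE mem_cat => /orP[] /mapP[q /sp[q1 q2 _] ->] //.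
have [|B' [B'c B'S B'm]] := blowup_around ir Sp; first by rewrite cS.
exists (fun j => if j == i then S else B' j), i, s; split=> //.
- exact: complete_insert.
- by move=> j jr; case: eqP => [_|/eqP ji]; rewrite ?B'm // cS; lia.
- move=> q qs; have [_ _ qe] := sp q qs; rewrite eqxx; split=> //.
    by rewrite inE mem_cat map_f.
  by rewrite inE mem_cat map_f ?orbT.
Qed.

Let part_ub i : r * #|part i| <= #|U| + d + r * m.
Proof.
have [->|/set0Pn[v vp]] := eqVneq (part i) set0; first by rewrite cards0; lia.
have vU : v \in U by move: vp; rewrite inE => /andP[].
have pU : part i \subset U by apply/subsetP => w; rewrite inE => /andP[].
have := degU vU; have := part_deg vp.
have : #|part i| <= #|part i :&: nbrs v| + #|U :\: nbrs v|.
  by rewrite -(cardsID (nbrs v) (part i)) leq_add2l subset_leq_card // setSD.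
rewrite (setIC (part i)); move: #|_ :&: _| #|_ :\: _| #|part i| #|U| => a b c k; nia.
Qed.

Lemma partition_of_blowup : exists p : V -> nat,
  let P i := [set v in U | p v == i] in
  [/\ forall v, v \in U -> p v < r,
      forall v, v \in U -> #|nbrs v :&: P (p v)| < m,
      \sum_(v in U) #|nbrs v :&: P (p v)| <= 4 * r * m * m &
      forall v, v \in U -> #|(U :\: P (p v)) :\: nbrs v| <= nu] /\
  forall i, i < r -> r * #|P i| <= #|U| + d + r * m /\
                     #|U| <= r * #|P i| + r * mu1.
Proof.
have vp v : v \in U -> v \in part (p v) by rewrite inE eqxx => ->.
exists p; split; first split.
- by move=> v /vp/part_lt.
- by move=> v /vp/part_deg.
- apply: leq_trans (_ : \sum_(i < r) \sum_(v in part i) #|nbrs v :&: part i| <= _).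
    rewrite (exchange_big_dep (mem U)) /=; last by move=> i v _; rewrite inE => /andP[].
    apply: leq_sum => v vU; rewrite (bigD1 (Ordinal (part_lt (vp v vU)))) /= ?leq_addr //.
    by rewrite inE vU eqxx.
  rewrite -!mulnA [4 * _]mulnCA -[X in X * _]card_ord -sum_nat_const mulnA.
  apply: leq_sum => i _; apply: internal_bound => //; last exact: part_match.
  by move=> v /part_deg/ltnW.
- move=> v vU; apply: leq_trans (part_out (vp v vU)).
  by apply: subset_leq_card; apply: setSD; apply: setDS; apply: W_part.
- move=> i ir; split; first exact: part_ub.
  have h1 := card_W_lb ir.
  have h2 : r * #|W i| <= r * #|part i| by rewrite leq_mul2l (subset_leq_card (W_part i)) orbT.
  by rewrite -/(part i) /mu1; lia.
Qed.

End Partition.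

(** The adjacencies inside parts obey absolute bounds, due to the excluded configurations. Missing
    adjacencies and part sizes are controlled only up to the proportion 1/K, due to the degree
    condition. *)
Definition near_turan (V : finType) (e : rel V) r m K (U : {set V}) (p : V -> nat) :=
  let P i := [set v in U | p v == i] in
  [/\ forall v, v \in U -> p v < r,
      forall v, v \in U -> #|nbrs e v :&: P (p v)| < m,
      \sum_(v in U) #|nbrs e v :&: P (p v)| <= 4 * r * m * m &
      forall v, v \in U -> K * #|(U :\: P (p v)) :\: nbrs e v| <= #|U|] /\
  forall i, i < r -> K * (r * #|P i|) <= K * #|U| + #|U| /\
                     K * #|U| <= K * (r * #|P i|) + #|U|.

(** With x = y + d + r m, all the sizes required by the partition are affine in x. Fixing one slope
    [M] for them first avoids circularity, since [t] and [E] are then chosen in terms of [M]. *)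
Lemma stability_constant r m K : 0 < r -> 0 < m -> 0 < K ->
  exists2 M, r <= M & forall x, let nu := x + (m + r * m * (x + m)) in
    [/\ r * (m + r * m * nu + 2 * m * nu + x) <= M * x + M,
        K * nu <= M * x + M & K * (r * x) <= M * x + M].
Proof.
move=> r0 m0 K0.
pose M1 := r * ((r * m + 2 * m) * (1 + r * m) + 1).
pose M2 := r * (m + (r * m + 2 * m) * (m + r * m * m)).
have M1r : r <= M1 by rewrite /M1 -[leqLHS]muln1 leq_mul2l leq_addl orbT.
have rm2 : 0 < r * m + 2 * m by rewrite addn_gt0 !muln_gt0 m0 orbT.
have M1rm : 1 + r * m <= M1.
  rewrite /M1 -[leqLHS]mul1n leq_mul //.
  by apply: leq_trans (leq_addr _ _); rewrite -[leqLHS]mul1n leq_mul.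
have M2rm : m + r * m * m <= M2.
  rewrite /M2 -[leqLHS]mul1n leq_mul //.
  by apply: leq_trans (leq_addl _ _); rewrite -[leqLHS]mul1n leq_mul.
have nuE x : x + (m + r * m * (x + m)) = (1 + r * m) * x + (m + r * m * m) by lia.
have UE x : r * (m + r * m * (x + (m + r * m * (x + m)))
    + 2 * m * (x + (m + r * m * (x + m))) + x) = M1 * x + M2.
  by rewrite nuE /M1 /M2; lia.
clearbody M1 M2.
exists (K * (M1 + M2)) => [|x nu];
  first by rewrite -[leqLHS]mul1n leq_mul // (leq_trans M1r) ?leq_addr.
rewrite /nu UE nuE.
have bound a b : a <= M1 -> b <= M2 -> a * x + b <= (M1 + M2) * x + (M1 + M2).
  by move=> ha hb; apply: leq_add; [rewrite leq_mul2r|];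
    rewrite ?(leq_trans ha) ?(leq_trans hb) ?leq_addr ?leq_addl ?orbT.
rewrite -mulnA -mulnDr leq_mul2l bound // leq_mul2l (leq_trans _ (bound r 0 M1r _)) ?addn0 ?orbT //.
by rewrite -[leqLHS]mul1n leq_mul ?bound.
Qed.

Theorem stability r m K : 0 < r -> 0 < m -> 0 < K -> exists E n0, 0 < E /\
  forall (V : finType) (e : rel V) (U : {set V}),
  symmetric e -> irreflexive e -> ~ star_config e r m -> ~ match_config e r m ->
  n0 <= #|U| ->
  (forall v, v \in U -> r * #|U :\: nbrs e v| <= #|U| + #|U| %/ E) ->
  exists p, near_turan e r m K U p.
Proof.
move=> r0 m0 K0.
have [M Mr MP] := stability_constant r0 m0 K0.
have M0 : 0 < M := leq_trans r0 Mr.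
(* This [t] yields 4 M y <= |U| + 16 M m d. Adding 4 M d makes the coefficient of d equal to [E],
   and E d <= |U|; hence M x + M <= |U| for large |U|. *)
pose t := 4 * M * m; pose E := 16 * M * m + 4 * M.
pose T' := 4 * m * t * (4 * r) ^ r.
exists E, (4 * M * (r * m + 1) + 4 * r * (T' * 2 ^ (r * T')) + 1); split.
  by rewrite /E; lia.
move=> V e U e_sym e_irr nstar nmatch; set k := #|U| => kn; set d := k %/ E => degU.
have Ed : E * d <= k by rewrite mulnC leq_trunc_div.
have t0 : 0 < t by rewrite !muln_gt0 M0 m0.
have [|||B [Bc BU]] := @blowup_exists V e e_sym U r d (4 * m * t) r r0 _ _ _ degU (leqnn r).
- by rewrite !muln_gt0 m0 M0.
- rewrite -/k; have [d0|d0] := posnP d.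
    by rewrite d0 muln0; apply: leq_trans kn; rewrite addn1.
  apply: leq_trans Ed; rewrite ltn_pmul2r // /E -/k.
  by apply: leq_trans (_ : 4 * M + 1 <= _);
    [rewrite addn1 ltnS leq_mul2l Mr orbT|rewrite addnC leq_add2r !muln_gt0 M0 m0].
- by rewrite -/T' -/k; lia.
rewrite subnn expn0 muln1 in BU.
pose y := (m * k + 4 * m * t * d) %/ t.
have y1 : m * k + 4 * m * t * d < y.+1 * t by apply: ltn_ceil.
have y2 : y * t <= m * k + 4 * m * t * d by apply: leq_trunc_div.
have {}y2 : 4 * M * y <= k + 16 * M * m * d.
  rewrite -(leq_pmul2l m0); move: y2; rewrite /t.
  by rewrite !mulnDr; move: (y) => ?; lia.
pose x := y + d + r * m.
have xk : M * x + M <= k.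
  rewrite -(leq_pmul2l (isT : 0 < 4)).
  have : 4 * M * (r * m + 1) <= k by apply: leq_trans kn; rewrite -addnA leq_addr.
  by move: y2 Ed; rewrite /E /x !mulnDr mulnDl; lia.
have [Mx1 Mx2 Mx3] := MP x.
have [|p [[p1 p2 p3 p4] p5]] := @partition_of_blowup V e e_sym e_irr U r m d t y B r0 m0 t0
  nstar nmatch degU y1 Bc
  (fun i ir => (BU i ir).1) (fun i ir => (BU i ir).2).
  by apply: leq_trans xk.
exists p; split; first split=> //.
- move=> v vU; apply: leq_trans xk; apply: leq_trans Mx2.
  by rewrite leq_mul2l p4 ?orbT.
- move=> i ir; have [h1 h2] := p5 i ir; rewrite -/k in h1 h2 *.
  have dx : K * (d + r * m) <= k.
    apply: leq_trans xk; apply: leq_trans Mx3; rewrite leq_mul2l; apply/orP; right.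
    by rewrite -[leqLHS]mul1n leq_mul // /x -addnA leq_addl.
  have Kx := leq_trans Mx3 xk.
  rewrite -(leq_pmul2l K0) in h1; rewrite -(leq_pmul2l K0) in h2.
  move: h1 h2 Kx dx; rewrite -/x; move: #|_| (k) (x) (d) => P' k' x' d'.
  by clear; rewrite !mulnDr; lia.
Qed.

(** * Stars and matchings in the parts of a free graph *)

Lemma adj_sym n (G : sgraph n) : symmetric (adj G).
Proof. by move=> x y; rewrite /adj setUC. Qed.

Lemma adj_irr n (G : sgraph n) : irreflexive (adj G).
Proof. by move=> x; apply/negbTE/negP => /adj_neq; rewrite eqxx. Qed.

Section GraphOfRel.
Variables (n : nat) (e : rel 'I_n).

Definition rel_edges : {set {set 'I_n}} :=
  [set [set p.1; p.2] | p : 'I_n * 'I_n & e p.1 p.2 && (p.1 != p.2)]%SET.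

Lemma rel_edges_card2 : [forall s in rel_edges, #|s| == 2].
Proof.
apply/forall_inP => s /imsetP[[x y] /=]; rewrite inE /= => /andP[_ xy] ->.
by rewrite cards2 xy.
Qed.

Definition graph_of_rel := SGraph rel_edges_card2.

Lemma set2_inj (x y z w : 'I_n) : [set x; y]%SET = [set z; w]%SET ->
  (x = z /\ y = w) \/ (x = w /\ y = z).
Proof.
move=> E.
have hx : x \in [set z; w]%SET by rewrite -E set21.
have hy : y \in [set z; w]%SET by rewrite -E set22.
have hz : z \in [set x; y]%SET by rewrite E set21.
have hw : w \in [set x; y]%SET by rewrite E set22.
case/set2P: hx => hx; case/set2P: hy => hy; subst; auto.
  by case/set2P: hw => hw; subst; auto.
by case/set2P: hz => hz; subst; auto.
Qed.

Lemma adj_graph_of_rel : symmetric e -> irreflexive e -> adj graph_of_rel =2 e.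
Proof.
move=> e_sym e_irr x y; apply/imsetP/idP => [[[z w]]|xy].
  rewrite inE /= => /andP[zw _] /set2_inj[] [-> ->] //.
  by rewrite e_sym.
exists (x, y) => //; rewrite inE /= xy; apply: contraTneq xy => ->.
by rewrite e_irr.
Qed.

End GraphOfRel.

Lemma adj_turan n r : adj (turan_graph n r) =2 (fun x y => x %% r != y %% r).
Proof.
move=> x y; apply/imsetP/idP => [[[z w]]|xy].
  rewrite inE /= => zw /set2_inj[] [-> ->] //.
  by rewrite eq_sym.
by exists (x, y); rewrite ?inE.
Qed.

Lemma handshake n (G : sgraph n) :
  2 * num_edges G = \sum_(x < n) \sum_(y < n) adj G x y.
Proof.
rewrite pair_big_dep /= -big_mkcond /= (partition_big (fun p : 'I_n * 'I_n => [set p.1;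
  p.2]%SET) (mem (edges G))) //=.
rewrite /num_edges mulnC -sum_nat_const; apply: eq_bigr => s sG.
have /forall_inP/(_ s sG)/cards2P[x [y [xy sE]]] := edges_card2 G.
apply: esym.
rewrite sum1_card (eq_card (B := mem [:: (x, y); (y, x)])).
  by rewrite (card_uniqP _) //= inE xpair_eqE negb_and xy.
move=> [z w]; rewrite !inE /= !xpair_eqE /adj; apply/andP/idP.
  by move=> [_ /eqP]; rewrite sE => /set2_inj[] /= [-> ->]; rewrite !eqxx ?orbT.
by move=> /orP[] /andP[/eqP -> /eqP ->]; rewrite /= ?(setUC [set y]) -sE sG eqxx.
Qed.

Lemma free_num_edges_le n (F : graph_family) (G : sgraph n) :
  family_free F G -> num_edges G <= ex n F.
Proof.
move=> GF; rewrite /ex.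
exact: (leq_bigmax_cond (P := fun G : sgraph n => `[< family_free F G >]) (F := fun G =>
  num_edges G) G (asboolT GF)).
Qed.

Section Embedding.
Variables (n r m : nat) (G : sgraph n).
Hypothesis r_gt0 : 0 < r.

(** The extra edges lie in residue class 0, the multiples of [r], where stars and matchings have
    simple arithmetic descriptions. *)
Definition turan_plus (e0 : rel 'I_n) : rel 'I_n := fun x y =>
  (x %% r != y %% r) || [&& x %% r == 0, y %% r == 0, x != y & e0 x y].

Lemma turan_plus_sym e0 : symmetric e0 -> symmetric (turan_plus e0).
Proof.
move=> s x y; rewrite /turan_plus s eq_sym (eq_sym x y); congr (_ || _).
by rewrite andbCA.
Qed.

Lemma turan_plus_irr e0 : irreflexive (turan_plus e0).
Proof. by move=> x; rewrite /turan_plus !eqxx /= !andbF. Qed.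

(** The order [a j < b j] orients the extra edges, so that injectivity of [b] is enough to make them
    distinct as sets. *)
Lemma turan_plus_edges e0 q (a b : 'I_q -> 'I_n) : symmetric e0 ->
  (forall j, [&& a j < b j, a j %% r == 0, b j %% r == 0 & e0 (a j) (b j)]) ->
  injective b ->
  num_edges (turan_graph n r) + q <= num_edges (graph_of_rel (turan_plus e0)).
Proof.
move=> e0_sym abP b_inj; rewrite /num_edges.
pose X := [set [set a j; b j] | j : 'I_q]%SET.
have <- : #|X| = q.
  rewrite card_imset ?card_ord // => j k /set2_inj[] [ajk bjk]; first exact: b_inj.
  have /andP[h1 _] := abP j; have /andP[h2 _] := abP k; exfalso.
  by move: h1 h2; rewrite ajk bjk; lia.
have disj : [disjoint turan_edges n r & X].
  rewrite -setI_eq0; apply/eqP/setP => s; rewrite !inE; apply/negP => /andP[].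
  move=> /imsetP[[x y]]; rewrite inE /= => xy -> /imsetP[j _].
  have /and4P[_ /eqP aj /eqP bj _] := abP j.
  by case/set2_inj => -[xE yE]; move: xy; rewrite xE yE aj bj eqxx.
rewrite -[X in X <= _]addn0 -(eqP (_ : #|turan_edges n r :&: X| == 0)); last first.
  by rewrite cards_eq0 setI_eq0.
rewrite -cardsUI [_ :&: _](_ : _ = set0) ?cards0 ?addn0; last first.
  by apply/eqP; rewrite setI_eq0.
apply: subset_leq_card; rewrite subUset; apply/andP; split; apply/subsetP => s.
  move=> /imsetP[[x y]]; rewrite inE /= => xy ->; apply/imsetP; exists (x, y) => //.
  by rewrite inE /= /turan_plus xy; apply: contraNneq xy => ->.
move=> /imsetP[j _ ->]; apply/imsetP; exists (a j, b j) => //.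
have /and4P[ab aj bj e0j] := abP j.
have anb : a j != b j by apply: contraTneq ab => ->; rewrite ltnn.
by rewrite inE /= /turan_plus aj bj e0j anb orbT.
Qed.

(* Sends the class of the Turan graph carrying the extra edges to an arbitrary
   part. *)
Definition swap0 i c := if c == 0 then i else if c == i then 0 else c.

Lemma swap0_lt i c : i < r -> c < r -> swap0 i c < r.
Proof. by rewrite /swap0; do 2?case: eqP. Qed.

Lemma swap0_inj i : injective (swap0 i).
Proof. by move=> c c'; rewrite /swap0; do 4?case: eqP; lia. Qed.

(** A copy [f] of [H] is carried into [G]: vertices in class 0 follow [h], and any other vertex x
    goes to the x-th element of its part, which exists because k <= m. Adjacency across parts is
    automatic, and injectivity matters only within a part since parts are disjoint. *)
Lemma contains_of_parts k (H : sgraph k) e0 (f : 'I_k -> 'I_n)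
    (B : nat -> {set 'I_n}) i (h : 'I_k -> 'I_n) :
  k <= m -> injective f -> symmetric e0 ->
  (forall x y, adj H x y -> turan_plus e0 (f x) (f y)) ->
  i < r -> complete_parts (adj G) (gtn r) B -> (forall j, j < r -> m <= #|B j|) ->
  (forall x, f x %% r = 0 -> h x \in B i) ->
  (forall x y, f x %% r = 0 -> f y %% r = 0 -> h x = h y -> x = y) ->
  (forall x y, f x %% r = 0 -> f y %% r = 0 -> f x != f y -> e0 (f x) (f y) ->
     adj G (h x) (h y)) ->
  contains G H.
Proof.
move=> km f_inj e0_sym fH ir Bc Bm hB h_inj h_adj.
pose part x := B (swap0 i (f x %% r)).
pose g x := if f x %% r == 0 then h x else nth (f x) (enum (part x)) x.
have sr x : swap0 i (f x %% r) < r by rewrite swap0_lt ?ltn_pmod.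
have size_part (x : 'I_k) (y : 'I_k) : x < size (enum (part y)).
  by rewrite -cardE; apply: leq_trans (Bm _ (sr y)); apply: leq_trans km.
have gB x : g x \in part x.
  rewrite /g; case: eqP => x0; first by rewrite /part x0 hB.
  by rewrite -mem_enum mem_nth.
have gadj x y : f x %% r != f y %% r -> adj G (g x) (g y).
  move=> xy; apply: (Bc (swap0 i (f x %% r)) (swap0 i (f y %% r))) (gB x) (gB y) => //=.
  by rewrite (inj_eq (@swap0_inj i)).
exists g; split=> [x y gxy|x y xy].
  have [fxy|/gadj] := eqVneq (f x %% r) (f y %% r); last by rewrite gxy adj_irr.
  move: gxy; rewrite /g /part -fxy; case: eqP => x0; first by apply: h_inj; rewrite -?fxy.
  have szx := size_part x x; have szy := size_part y x.
  move: szx szy; rewrite /part; move: (enum _) (enum_uniq (B (swap0 i (f x %% r)))) => l ul szx szy.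
  rewrite (set_nth_default (f x) (f y) szy) => /eqP; rewrite nth_uniq // => /eqP; exact: val_inj.
have [fxy|/gadj//] := eqVneq (f x %% r) (f y %% r).
have := fH x y xy; rewrite /turan_plus fxy eqxx /= => /and4P[/eqP y0 _ nxy e0xy].
by rewrite /g fxy y0 eqxx; apply: h_adj; rewrite ?fxy.
Qed.

Lemma star_contains k (H : sgraph k) :
  k <= m -> contains (graph_of_rel (turan_plus (fun x y : 'I_n =>
    (x == 0 :> nat) || (y == 0 :> nat)))) H ->
  star_config (adj G) r m -> contains G H.
Proof.
set e0 := (fun x y : 'I_n => _) => km [f [f_inj fH]] [B [i [v [L [ir Bc Bm [vB LB] [mL LN]]]]]].
have e0_sym : symmetric e0 by move=> x y; rewrite /e0 orbC.
have szL (x : 'I_k) : x < size (enum L).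
  by rewrite -cardE; apply: leq_trans mL; apply: leq_trans km.
have vL : v \notin L by apply/negP => /(subsetP LN); rewrite inE adj_irr.
pose h x := if f x == 0 :> nat then v else nth v (enum L) x.
have hL x : f x != 0 :> nat -> h x \in L.
  by move=> x0; rewrite /h (negbTE x0) -mem_enum mem_nth.
apply: (contains_of_parts (e0 := e0) (f := f) (h := h) km f_inj e0_sym _ ir Bc Bm) => //.
- move=> x y /fH; rewrite adj_graph_of_rel //; last exact: turan_plus_irr.
  exact: turan_plus_sym.
- move=> x _; have [x0|x0] := eqVneq (f x : nat) 0; last by apply: subsetP LB _ (hL x x0).
  by rewrite /h x0.
- move=> x y _ _.
  have [x0|x0] := eqVneq (f x : nat) 0; have [y0|y0] := eqVneq (f y : nat) 0.
  + by move=> _; apply: f_inj; apply: val_inj; rewrite /= x0 y0.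
  + by rewrite {1}/h x0 eqxx => hv; have := hL y y0; rewrite -hv (negbTE vL).
  + by rewrite {2}/h y0 eqxx => hv; have := hL x x0; rewrite hv (negbTE vL).
  + rewrite /h (negbTE x0) (negbTE y0) => /eqP; rewrite nth_uniq ?enum_uniq //.
    by move/eqP/val_inj.
- move=> x y _ _ fxy; rewrite /e0; have vh z : f z != 0 :> nat -> adj G v (h z).
    by move=> z0; have /(subsetP LN) := hL z z0; rewrite inE.
  have [x0|x0] := eqVneq (f x : nat) 0; have [y0|y0] := eqVneq (f y : nat) 0 => //= _.
  + by case/eqP: fxy; apply: val_inj; rewrite /= x0 y0.
  + by rewrite {1}/h x0 eqxx vh.
  + by rewrite {2}/h y0 eqxx adj_sym vh.
Qed.

(** On multiples of [r], equality of the quotients by 2r pairs 2jr with (2j+1)r. The block of a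
    vertex selects an edge of the matching [s], and the parity of its quotient by [r] selects an
    end. *)
Lemma match_contains k (H : sgraph k) :
  k <= m -> contains (graph_of_rel (turan_plus (fun x y : 'I_n =>
    x %/ (2 * r) == y %/ (2 * r)))) H ->
  match_config (adj G) r m -> contains G H.
Proof.
set e0 := (fun x y : 'I_n => _) => km [f [f_inj fH]] [B [i [s [ir Bc Bm [ss us] sB]]]].
have e0_sym : symmetric e0 by move=> x y; rewrite /e0 eq_sym.
pose b x := f x %/ (2 * r).
pose bs := [seq b x | x <- enum 'I_k].
(* Up to n/2r blocks exist, but at most k of them are met by the copy. Numbering these by first
   occurrence keeps the index below the length [m] of [s]. *)
pose idx x := index (b x) bs.
have b_bs x : b x \in bs by rewrite map_f ?mem_enum.
have idx_lt x : idx x < size s.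
  have : idx x < size bs by rewrite index_mem.
  by rewrite size_map size_enum_ord ss => h; apply: leq_trans km.
have idx_inj x y : idx x = idx y -> b x = b y.
  by move=> E; rewrite -(nth_index 0 (b_bs x)) -(nth_index 0 (b_bs y)) -/(idx x) E.
pose side x := odd (f x %/ r).
pose edge x := nth (f x, f x) s (idx x).
pose h x := if side x then (edge x).2 else (edge x).1.
have edge_s x : edge x \in s by rewrite mem_nth.
have side_inj x y : f x %% r = 0 -> f y %% r = 0 -> b x = b y -> side x = side y -> x = y.
  move=> x0 y0; rewrite /b /side ![2 * r]mulnC !divnMA => bxy sxy.
  apply: f_inj; apply: val_inj; rewrite /= (divn_eq (f x) r) (divn_eq (f y) r) x0 y0.
  by rewrite -(odd_double_half (f x %/ r)) -(odd_double_half (f y %/ r)) sxy -!divn2 bxy.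
have h_nth x : h x = nth (f x) (unzip1 s ++ unzip2 s) (if side x then size s + idx x else idx x).
  rewrite /h nth_cat size_map; case: ifP => _; last by rewrite idx_lt (nth_map (f x, f x)).
  by rewrite ltnNge leq_addr /= addKn (nth_map (f x, f x)).
have pos_lt x : (if side x then size s + idx x else idx x) < size (unzip1 s ++ unzip2 s).
  by rewrite size_cat !size_map; have := idx_lt x; case: ifP; lia.
apply: (contains_of_parts (e0 := e0) (f := f) (h := h) km f_inj e0_sym _ ir Bc Bm) => //.
- move=> x y /fH; rewrite adj_graph_of_rel //; last exact: turan_plus_irr.
  exact: turan_plus_sym.
- by move=> x _; have [h1 h2 _] := sB _ (edge_s x); rewrite /h; case: ifP.
- move=> x y x0 y0; rewrite !h_nth (set_nth_default (f x) (f y)) //.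
  move/eqP; rewrite nth_uniq // => /eqP pos.
  have := idx_lt x; have := idx_lt y; move: pos.
  case sx: (side x); case sy: (side y) => pos ly lx; try (by exfalso; lia);
  by apply: side_inj; rewrite ?sx ?sy //; apply: idx_inj; lia.
- move=> x y x0 y0 fxy; rewrite /e0 => /eqP bxy.
  have idxE : idx x = idx y by rewrite /idx /b bxy.
  have edgeE : edge x = edge y by rewrite /edge idxE; apply: set_nth_default.
  have sxy : side x != side y.
    by apply: contraNneq fxy => sxy; rewrite (side_inj x y).
  have [_ _ ey] := sB _ (edge_s y).
  move: sxy; rewrite /h edgeE; case: (side x); case: (side y) => // _.
  by rewrite adj_sym.
Qed.

Hypothesis n_large : 2 * r <= n.

Lemma star_edges : num_edges (turan_graph n r) + n %/ (2 * r) <=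
  num_edges (graph_of_rel (turan_plus (fun x y : 'I_n => (x == 0 :> nat) || (y == 0 :> nat)))).
Proof.
have n0 : 0 < n by lia.
have b_lt (j : 'I_(n %/ (2 * r))) : r * j.+1 < n.
  have := ltn_ord j; rewrite leq_divRL; last by lia.
  by move: (j : nat) => q; nia.
apply: (@turan_plus_edges _ _ (fun=> Ordinal n0) (fun j => Ordinal (b_lt j))).
- by move=> x y; rewrite orbC.
- by move=> j /=; rewrite mod0n modnMr eqxx !andbT muln_gt0 r_gt0.
- move=> j k /(congr1 val) /= /eqP; rewrite eqn_pmul2l // => /eqP[jk].
  exact: val_inj.
Qed.

Lemma match_edges : num_edges (turan_graph n r) + n %/ (2 * r) <=
  num_edges (graph_of_rel (turan_plus (fun x y : 'I_n => x %/ (2 * r) == y %/ (2 * r)))).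
Proof.
have jn (j : 'I_(n %/ (2 * r))) : j.+1 * (2 * r) <= n.
  by rewrite -leq_divRL //; lia.
have a_lt (j : 'I_(n %/ (2 * r))) : j * (2 * r) < n by have := jn j; lia.
have b_lt (j : 'I_(n %/ (2 * r))) : j * (2 * r) + r < n by have := jn j; lia.
apply: (@turan_plus_edges _ _ (fun j => Ordinal (a_lt j)) (fun j => Ordinal (b_lt j))).
- by move=> x y; rewrite eq_sym.
- move=> j /=; rewrite -{1}[j * _]addn0 ltn_add2l r_gt0 /= modnDr mulnA modnMl eqxx /=.
  rewrite -mulnA divnMDl ?mulnK ?(divn_small (m := r)) ?addn0 //; lia.
- move=> j k /(congr1 val) /= /eqP; rewrite eqn_add2r eqn_pmul2r; last by lia.
  by move=> /eqP; apply: val_inj.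
Qed.

Lemma free_no_configs (F : graph_family) : order_bounded F m ->
  ex n F < num_edges (turan_graph n r) + n %/ (2 * r) -> family_free F G ->
  ~ star_config (adj G) r m /\ ~ match_config (adj G) r m.
Proof.
move=> Fm exF GF.
have member (G' : sgraph n) : num_edges (turan_graph n r) + n %/ (2 * r) <= num_edges G' ->
    exists k (H : sgraph k), F k H /\ contains G' H.
  move=> G'e; apply: contrapT => noH.
  have /free_num_edges_le : family_free F G'.
    by move=> k H FH GH; apply: noH; exists k, H.
  by move: exF; lia.
split.
  have [k [H [FH GH]]] := member _ star_edges.
  by move=> /(star_contains (Fm _ _ FH) GH); apply: GF.
have [k [H [FH GH]]] := member _ match_edges.
by move=> /(match_contains (Fm _ _ FH) GH); apply: GF.
Qed.

End Embedding.

Local Open Scope ring_scope.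

(** * Perron vectors *)

Definition rel_matrix (K : pzRingType) n (e : rel 'I_n) : 'M[K]_n :=
  \matrix_(u, v) (e u v)%:R.

HB.lock Definition rel_radius (R : realType) n (e : rel 'I_n) : R :=
  spectral_radius (rel_matrix R[i] e).

Lemma rho_rel_radius (R : realType) n (G : sgraph n) :
  rho R G = rel_radius R (adj G).
Proof. by rewrite rel_radius.unlock. Qed.

Section Perron.
Variables (R : realType) (n : nat) (e : rel 'I_n).
Hypothesis e_sym : symmetric e.
Hypothesis n_gt0 : (0 < n)%N.

Local Notation C := R[i].
Local Notation l := (rel_radius R e).
Local Open Scope sesquilinear_scope.
Local Open Scope complex_scope.

Lemma rel_matrix_diag : exists (P : 'M[C]_n) (d : 'rV[C]_n),
  [/\ rel_matrix C e = P^t* *m diag_mx d *m P, P *m P^t* = 1%:M &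
      forall i, d 0 i \is Num.real].
Proof.
have A_herm : rel_matrix C e \is hermsymmx.
  apply: realsym_hermsym; last by apply/mxOverP => u v; rewrite mxE realn.
  apply/is_hermitianmxP; rewrite expr0 scale1r; apply/matrixP => u v.
  by rewrite !mxE e_sym.
exists (spectralmx (rel_matrix C e)), (spectral_diag (rel_matrix C e)); split.
- have /orthomx_spectralP := hermitian_normalmx A_herm.
  by rewrite invmx_unitary ?spectral_unitarymx.
- exact/unitarymxP/spectral_unitarymx.
- by have /mxOverP := hermitian_spectral_diag_real A_herm.
Qed.

Section Diagonalization.
Variables (A P : 'M[C]_n) (d : 'rV[C]_n).
Hypothesis A_diag : A = P^t* *m diag_mx d *m P.
Hypothesis PP : P *m P^t* = 1%:M.

Let PtP : P^t* *m P = 1%:M := mulmx1C PP.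

Lemma eigen_diag i : eigenvalue A (d 0 i).
Proof.
apply/eigenvalueP; exists (row i P).
  rewrite A_diag -row_mul !mulmxA PP mul1mx row_mul.
  by rewrite row_diag_mx -scalemxAl -rowE.
apply/eqP => r0; have := congr1 (fun M => M *m P^t*) r0.
rewrite -row_mul PP mul0mx => /rowP/(_ i) /eqP.
by rewrite !mxE eqxx oner_eq0.
Qed.

Lemma eigenvalue_diag a : eigenvalue A a -> exists i, a = d 0 i.
Proof.
move=> /eigenvalueP[v va v0]; set w := v *m P^t*.
have w0 : w != 0.
  by apply: contraNneq v0 => w0; rewrite -[v]mulmx1 -PtP mulmxA -/w w0 mul0mx.
have wE : w *m diag_mx d = a *: w.
  by rewrite scalemxAl -va A_diag !mulmxA -[_ *m P *m _]mulmxA PP mulmx1.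
have /existsP[i wi] : [exists i, w 0 i != 0].
  apply: contraNT w0; rewrite negb_exists => /forallP h.
  by apply/eqP/rowP => i; rewrite [RHS]mxE; apply/eqP; move: (h i); rewrite negbK.
exists i; move/rowP/(_ i): wE; rewrite mul_mx_diag mxE [RHS]mxE mulrC.
by move=> /(mulIf wi).
Qed.

End Diagonalization.

Lemma radius_attained (P : 'M[C]_n) (d : 'rV[C]_n) :
  rel_matrix C e = P^t* *m diag_mx d *m P -> P *m P^t* = 1%:M ->
  exists i, l = Normc.normc (d 0 i) /\ forall j, Normc.normc (d 0 j) <= l.
Proof.
move=> A_diag PP.
have eigen_d i := eigen_diag A_diag PP i.
have eigen_in_d a := eigenvalue_diag A_diag PP (a := a).
pose i := [arg max_(i > Ordinal n_gt0) Normc.normc (d 0 i)]%O.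
have i_max j : Normc.normc (d 0 j) <= Normc.normc (d 0 i).
  by rewrite /i; case: arg_maxP => // k _; apply.
have lE : l = Normc.normc (d 0 i).
  apply/eqP; rewrite rel_radius.unlock eq_le; apply/andP; split.
    apply: ge_sup; first by exists (Normc.normc (d 0 i)), (d 0 i) => //; apply: eigen_d.
    by move=> _ [a /eigen_in_d[j ->] <-].
  apply: ub_le_sup; last by exists (d 0 i) => //; apply: eigen_d.
  by exists (Normc.normc (d 0 i)) => _ [a /eigen_in_d[j ->] <-].
by exists i; split=> // j; rewrite lE.
Qed.

Lemma rayleigh (y : 'I_n -> R) :
  \sum_u \sum_v (e u v)%:R * y u * y v <= l * \sum_u y u ^+ 2.
Proof.
have [P [d [A_diag PP d_real]]] := rel_matrix_diag.
have PtP := mulmx1C PP; set A := rel_matrix C e in A_diag.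
pose Y : 'rV[C]_n := \row_u (y u)%:C; pose z := Y *m P^t*.
have Yr : Y^t* = Y^T.
  by apply/matrixP => u v; rewrite !mxE; apply/CrealP; apply/complex_realP; eexists.
have zt : z^t* = P *m Y^T.
  by rewrite /z trmx_mul map_mxM trmxCK Yr.
have Ey : (Y *m A *m Y^T) 0 0 = (\sum_u \sum_v (e u v)%:R * y u * y v)%:C.
  rewrite exchange_big mxE rmorph_sum /=; apply: eq_bigr => v _.
  rewrite !mxE rmorph_sum mulr_suml; apply: eq_bigr => u _.
  by rewrite !mxE !rmorphM /= rmorph_nat /=; ring.
have Ny : (Y *m Y^T) 0 0 = (\sum_u y u ^+ 2)%:C.
  by rewrite mxE rmorph_sum /=; apply: eq_bigr => u _; rewrite !mxE -rmorphM.
have Ez : (Y *m A *m Y^T) 0 0 = \sum_i d 0 i * (z 0 i * (z 0 i)^*).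
  rewrite A_diag !mulmxA -/z -mulmxA -zt mxE; apply: eq_bigr => i _.
  by rewrite mul_mx_diag !mxE; ring.
have Nz : (Y *m Y^T) 0 0 = \sum_i z 0 i * (z 0 i)^*.
  rewrite -[Y in Y *m _]mulmx1 -PtP mulmxA -/z -mulmxA -zt mxE.
  by apply: eq_bigr => i _; rewrite !mxE.
rewrite -lecR -Ey rmorphM /= -Ny Ez Nz mulr_sumr; apply: ler_sum => i _.
apply: ler_wpM2r; first by exact: mul_conjC_ge0.
have [j [lE l_max]] := radius_attained A_diag PP.
rewrite (le_trans (real_ler_norm (d_real i))) //.
have -> : `|d 0 i| = (Normc.normc (d 0 i))%:C by [].
by rewrite lecR.
Qed.

Lemma radius_ge0 : 0 <= l.
Proof.
have [P [d [A_diag PP d_real]]] := rel_matrix_diag.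
have [i [-> _]] := radius_attained A_diag PP.
by rewrite -(@ler0c R) -[(_)%:C]/(`|d 0 i|) normr_ge0.
Qed.

(** The moduli x of an eigenvector whose eigenvalue has the largest modulus satisfy A x >= l x
    entrywise, and the Rayleigh bound forces the excess w = A x - l x to vanish. The graph may be
    disconnected, so weights may be 0. *)
Lemma perron_vector : exists x : 'I_n -> R,
  [/\ forall v, 0 <= x v <= 1, exists v, x v = 1 &
      forall v, \sum_w (e v w)%:R * x w = l * x v].
Proof.
have [P [d [A_diag PP d_real]]] := rel_matrix_diag.
have [i [lE _]] := radius_attained A_diag PP.
have /eigenvalueP[z zA z0] := eigen_diag A_diag PP i.
pose x v := Normc.normc (z 0 v).
have x0 v : 0 <= x v by rewrite -(@ler0c R) -[(_)%:C]/(`|z 0 v|) normr_ge0.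
have lx v : l * x v <= \sum_w (e v w)%:R * x w.
  rewrite -(@lecR R) rmorphM /= rmorph_sum /= lE.
  rewrite -[_%:C * _%:C]/(`|d 0 i| * `|z 0 v|) -normrM.
  move/rowP/(_ v): zA; rewrite [RHS]mxE => <-; rewrite mxE.
  apply: le_trans (ler_norm_sum _ _ _) _; apply: ler_sum => w _.
  by rewrite !mxE normrM mulrC rmorphM /= rmorph_nat normr_nat e_sym.
pose w v := \sum_u (e v u)%:R * x u - l * x v.
have w0 v : 0 <= w v by rewrite subr_ge0.
have Ax v : \sum_u (e v u)%:R * x u = l * x v + w v by rewrite /w; ring.
have qf (f g : 'I_n -> R) : \sum_u \sum_v (e u v)%:R * f u * g v =
    \sum_u f u * \sum_v (e u v)%:R * g v.
  by apply: eq_bigr => u _; rewrite mulr_sumr; apply: eq_bigr => v _; ring.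
have wx : \sum_u x u * \sum_v (e u v)%:R * w v = \sum_u w u * \sum_v (e u v)%:R * x v.
  rewrite -!qf exchange_big /=; apply: eq_bigr => u _; apply: eq_bigr => v _.
  by rewrite e_sym; ring.
have w_eq0 : \sum_v w v ^+ 2 = 0.
  apply/eqP; rewrite eq_le; apply/andP; split; last by apply: sumr_ge0 => v _; apply: sqr_ge0.
  have l0 := radius_ge0.
  (* Testing the Rayleigh bound with x + t w leaves <x,w> + 2 t |w|^2 + t^2 <w, A w> <= t^2 l |w|^2.
     As t l <= 1 and the other terms are nonnegative, |w|^2 = 0. *)
  pose t := (l + 1)^-1; have t0 : 0 < t by rewrite invr_gt0; lra.
  have := rayleigh (fun v => x v + t * w v); rewrite qf.
  have -> : \sum_u (x u + t * w u) ^+ 2 =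
      \sum_u x u ^+ 2 + 2 * t * (\sum_u x u * w u) + t ^+ 2 * \sum_u w u ^+ 2.
    by rewrite !mulr_sumr -!big_split; apply: eq_bigr => u _ /=; ring.
  have -> : \sum_u (x u + t * w u) * (\sum_v (e u v)%:R * (x v + t * w v)) =
      \sum_u x u * (\sum_v (e u v)%:R * x v)
      + t * (\sum_u x u * \sum_v (e u v)%:R * w v)
      + t * (\sum_u w u * \sum_v (e u v)%:R * x v)
      + t ^+ 2 * (\sum_u w u * \sum_v (e u v)%:R * w v).
    rewrite !mulr_sumr -!big_split; apply: eq_bigr => u _ /=.
    have -> : \sum_v (e u v)%:R * (x v + t * w v) =
        \sum_v (e u v)%:R * x v + t * \sum_v (e u v)%:R * w v.
      by rewrite mulr_sumr -big_split; apply: eq_bigr => v _ /=; ring.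
    by ring.
  rewrite wx.
  have -> : \sum_u x u * (\sum_v (e u v)%:R * x v) =
      l * (\sum_u x u ^+ 2) + \sum_u x u * w u.
    by rewrite mulr_sumr -big_split; apply: eq_bigr => u _ /=; rewrite Ax; ring.
  have -> : \sum_u w u * (\sum_v (e u v)%:R * x v) =
      l * (\sum_u x u * w u) + \sum_u w u ^+ 2.
    by rewrite mulr_sumr -big_split; apply: eq_bigr => u _ /=; rewrite Ax; ring.
  have : 0 <= \sum_u x u * w u by apply: sumr_ge0 => u _; apply: mulr_ge0.
  have : 0 <= \sum_u w u * (\sum_v (e u v)%:R * w v).
    by apply: sumr_ge0 => u _; apply: mulr_ge0 => //; apply: sumr_ge0 => v _; apply: mulr_ge0.
  have : 0 <= \sum_u w u ^+ 2 by apply: sumr_ge0 => v _; apply: sqr_ge0.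
  move: (\sum_u x u ^+ 2) (\sum_u x u * w u) (\sum_u w u ^+ 2) (\sum_u w u * _) => X s a b.
  move=> a0 b0 s0 h.
  have {}h : t * (2 * a) <= t * (t * (l * a)).
    have : 0 <= t ^+ 2 * b by apply: mulr_ge0 => //; apply: sqr_ge0.
    by move: h; rewrite !mulrDr !mulrA -!expr2; lra.
  have : t * (l * a) <= a.
    rewrite mulrA -[leRHS]mul1r; apply: ler_wpM2r => //.
    by rewrite mulrC ler_pdivrMr; lra.
  by move: h; rewrite ler_pM2l //; lra.
have {}w_eq0 v : w v = 0.
  have := psumr_eq0P (fun v _ => sqr_ge0 (w v)) w_eq0 (i := v) isT.
  by move/eqP; rewrite sqrf_eq0 => /eqP.
pose v0 := [arg max_(v > Ordinal n_gt0) x v]%O.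
have v0P v : x v <= x v0 by rewrite /v0; case: arg_maxP => // k _; apply.
have xv0 : 0 < x v0.
  rewrite lt_neqAle x0 andbT eq_sym; apply: contraNneq z0 => xv0.
  apply/eqP/rowP => v; rewrite [RHS]mxE; apply: Normc.eq0_normc.
  by apply/eqP; rewrite eq_le -{1}xv0 v0P x0.
exists (fun v => x v / x v0); split.
- move=> v; apply/andP; split; first by apply: divr_ge0 => //; apply: ltW.
  by rewrite ler_pdivrMr // mul1r.
- by exists v0; rewrite divff ?gt_eqF.
- move=> v; have := Ax v; rewrite w_eq0 addr0 => Axv.
  rewrite mulrA -Axv mulr_suml.
  by apply: eq_bigr => u _; rewrite mulrA.
Qed.

End Perron.

(** Weighted Cauchy-Schwarz, obtained by expanding the sum of w_i (a_i/w_i - S/W)^2. It is stated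
    with an upper bound [W] on the total weight because the sharp form bound only knows that its
    weights sum to at most 1. *)
Lemma sq_sum_le (R : realFieldType) (I : finType) (P : pred I) (a w : I -> R) (W : R) :
  (forall i, P i -> 0 < w i) -> \sum_(i | P i) w i <= W ->
  (\sum_(i | P i) a i) ^+ 2 <= W * \sum_(i | P i) a i ^+ 2 / w i.
Proof.
move=> w0 wW; set S := \sum_(i | P i) a i.
have W0 : 0 <= W by apply: le_trans wW; apply: sumr_ge0 => i /w0/ltW.
have [WE|Wn0] := eqVneq W 0.
  rewrite WE mul0r; have [i Pi|P0] := pickP P; last by rewrite /S big_pred0 // expr0n.
  have := w0 i Pi; suff : w i <= 0 by lra.
  rewrite -WE; apply: le_trans wW; rewrite (bigD1 i) //= lerDl.
  by apply: sumr_ge0 => j /andP[/w0/ltW].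
have Wp : 0 < W by rewrite lt_neqAle eq_sym Wn0.
rewrite mulrC -ler_pdivrMr //.
have : 0 <= \sum_(i | P i) w i * (a i / w i - S / W) ^+ 2.
  by apply: sumr_ge0 => i /w0/ltW ?; apply: mulr_ge0 => //; apply: sqr_ge0.
have -> : \sum_(i | P i) w i * (a i / w i - S / W) ^+ 2 =
    \sum_(i | P i) a i ^+ 2 / w i - 2 * (S / W) * S + (S / W) ^+ 2 * \sum_(i | P i) w i.
  rewrite /S !mulr_sumr -sumrB -big_split /=; apply: eq_bigr => i /w0 wi.
  by field; rewrite Wn0 gt_eqF.
have : (S / W) ^+ 2 * \sum_(i | P i) w i <= (S / W) ^+ 2 * W.
  by apply: ler_wpM2l => //; apply: sqr_ge0.
have -> : (S / W) ^+ 2 * W = S ^+ 2 / W by field.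
have -> : 2 * (S / W) * S = 2 * (S ^+ 2 / W) by field.
by lra.
Qed.

Lemma sq_sum_le_card (R : realFieldType) (I : finType) (P : pred I) (a : I -> R) :
  (\sum_(i | P i) a i) ^+ 2 <= #|P|%:R * \sum_(i | P i) a i ^+ 2.
Proof.
rewrite [in leRHS](eq_bigr (fun i => a i ^+ 2 / 1)); last by move=> i _; rewrite divr1.
by apply: (@sq_sum_le R I P a (fun=> 1)) => [i _|]; rewrite ?ltr01 // sumr_const.
Qed.

Section Induced.
Variables (R : realType) (n : nat) (e : rel 'I_n).
Hypothesis e_sym : symmetric e.
Hypothesis e_irr : irreflexive e.
Hypothesis n_gt0 : (0 < n)%N.

(** Deleted vertices stay as isolated ones, so all subgraphs share the vertex type and their radii
    can be compared directly. *)
Definition induced (U : {set 'I_n}) : rel 'I_n :=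
  fun u v => [&& u \in U, v \in U & e u v].

Lemma induced_sym U : symmetric (induced U).
Proof. by move=> u v; rewrite /induced e_sym andbCA. Qed.

Local Notation l U := (rel_radius R (induced U)).

Lemma perron_induced U : exists x : 'I_n -> R,
  [/\ forall v, 0 <= x v <= 1, exists v, x v = 1,
      forall v, \sum_w (induced U v w)%:R * x w = l U * x v &
      0 < l U -> forall v, v \notin U -> x v = 0].
Proof.
have [x [x01 x1 xE]] := perron_vector R (@induced_sym U) n_gt0.
exists x; split=> // l0 v vU.
have : l U * x v = 0.
  by rewrite -xE big1 // => w _; rewrite /induced (negbTE vU) mul0r.
by move/eqP; rewrite mulf_eq0 gt_eqF //= => /eqP.
Qed.

Lemma radius_le_card U : l U <= #|U|%:R.
Proof.
have [x [x01 [v xv] xE _]] := perron_induced U.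
have := xE v; rewrite xv mulr1 => <-.
rewrite -sum1_card natr_sum [leRHS]big_mkcond /=; apply: ler_sum => w _.
have /andP[w0 w1] := x01 w; rewrite /induced.
case: (v \in U); case: (w \in U); case: (e v w) => /=; rewrite ?mul0r ?mul1r //.
Qed.

Lemma quad_eigen U (x : 'I_n -> R) :
  (forall v, \sum_w (induced U v w)%:R * x w = l U * x v) ->
  \sum_u \sum_v (induced U u v)%:R * x u * x v = l U * \sum_u x u ^+ 2.
Proof.
move=> xE; rewrite mulr_sumr; apply: eq_bigr => u _.
rewrite (_ : _ * x u ^+ 2 = x u * (l U * x u)); last by ring.
by rewrite -xE mulr_sumr; apply: eq_bigr => v _; ring.
Qed.

Lemma sum_sq_gt0 (x : 'I_n -> R) v : x v = 1 -> 1 <= \sum_u x u ^+ 2.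
Proof.
move=> xv; rewrite (bigD1 v) //= xv expr1n lerDl.
by apply: sumr_ge0 => u _; apply: sqr_ge0.
Qed.

Lemma multipartite_form (p : 'I_n -> nat) r (y : 'I_n -> R) :
  (forall u, y u != 0 -> (p u < r)%N) ->
  \sum_u \sum_v (p u != p v)%:R * y u * y v =
  (\sum_u y u) ^+ 2 - \sum_(i < r) (\sum_(u | p u == i) y u) ^+ 2.
Proof.
move=> yp.
have -> : \sum_(i < r) (\sum_(u | p u == i) y u) ^+ 2 =
    \sum_u \sum_v (p u == p v)%:R * y u * y v.
  under eq_bigr do rewrite expr2 mulr_suml big_mkcond /=.
  rewrite exchange_big /=; apply: eq_bigr => u _.
  have [yu|/yp pu] := eqVneq (y u) 0.
    rewrite big1 ?big1 // => [i _|i _]; last by rewrite yu mul0r if_same.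
    by rewrite yu mulr0 mul0r.
  have pu_neq (i : 'I_r) : i != Ordinal pu -> (p u == i) = false.
    by move=> ip; apply: contra_neqF ip => /eqP pi; apply: val_inj.
  rewrite (bigD1 (Ordinal pu)) //= eqxx [X in _ + X]big1 ?addr0 => [|i /pu_neq -> //].
  rewrite mulr_sumr [LHS]big_mkcond; apply: eq_bigr => v _.
  by rewrite eq_sym; case: eqP; rewrite ?mul1r ?mul0r.
rewrite expr2 mulr_suml -sumrB; apply: eq_bigr => u _.
rewrite mulr_sumr -sumrB; apply: eq_bigr => v _.
by case: eqP => _; rewrite /= ?mul0r ?mul1r ?subrr ?subr0.
Qed.

End Induced.

(** * Spectral stability by vertex deletion *)

Section Deletion.
Variables (R : realType) (n : nat) (e : rel 'I_n).
Hypothesis e_sym : symmetric e.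
Hypothesis e_irr : irreflexive e.
Hypothesis n_gt0 : (0 < n)%N.
Implicit Types U : {set 'I_n}.

Local Notation l U := (rel_radius R (induced e U)).

Lemma sum_supported U (f : 'I_n -> R) : (forall v, v \notin U -> f v = 0) ->
  \sum_v f v = \sum_(v in U) f v.
Proof.
by move=> f0; rewrite [RHS]big_mkcond; apply: eq_bigr => v _; case: ifPn => // /f0.
Qed.

(** Cauchy-Schwarz twice: over the [r] parts for the subtracted squares, then over [U] for the
    square of the total. *)
Lemma multipartite_form_le U (p : 'I_n -> nat) r (y : 'I_n -> R) : (0 < r)%N ->
  (forall v, v \in U -> (p v < r)%N) -> (forall v, v \notin U -> y v = 0) ->
  \sum_u \sum_v (p u != p v)%:R * y u * y v <= (1 - r%:R^-1) * #|U|%:R * \sum_u y u ^+ 2.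
Proof.
move=> r0 pr yU.
have rR : (0 : R) < r%:R by rewrite ltr0n.
rewrite (@multipartite_form R n p r) => [|u yu]; last first.
  by apply: pr; apply: contra_neqT yu => /yU.
have S2 : (\sum_u y u) ^+ 2 <= #|U|%:R * \sum_u y u ^+ 2.
  have E2 : \sum_u y u ^+ 2 = \sum_(u in U) y u ^+ 2.
    by apply: sum_supported => v /yU ->; rewrite expr0n.
  by rewrite (sum_supported yU) E2; apply: (sq_sum_le_card (fun u => u \in U) y).
have Si : (\sum_u y u) ^+ 2 <= r%:R * \sum_(i < r) (\sum_(u | p u == i) y u) ^+ 2.
  have -> : \sum_u y u = \sum_(i < r) \sum_(u | p u == i) y u.
    rewrite (sum_supported yU).
    have E (i : 'I_r) : \sum_(u | p u == i) y u = \sum_(u in U) (if p u == i then y u else 0).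
      rewrite big_mkcond; apply: sum_supported => v /yU ->; exact: if_same.
    under [RHS]eq_bigr do rewrite E.
    rewrite exchange_big /=; apply: eq_bigr => u /pr pu.
    rewrite -big_mkcond /= (big_pred1 (Ordinal pu)) //.
  by have := sq_sum_le_card predT (fun i : 'I_r => \sum_(u | p u == i) y u); rewrite card_ord.
rewrite -mulrA; apply: le_trans (_ : (1 - r%:R^-1) * (\sum_u y u) ^+ 2 <= _).
  rewrite mulrBl mul1r lerD2l lerN2 mulrC ler_pdivrMr // mulrC //.
apply: ler_wpM2l => //; rewrite subr_ge0 invf_le1 // ler1n //.
Qed.

(** The at most 4 r m m ordered adjacent pairs inside parts contribute at most 1 each to the
    quadratic form. The eigenvalue equation at a weight 1 gives l^2 <= |U| N, so N >= |U|/16 and the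
    excess is at most 64 r m m / |U|. *)
Lemma radius_near_turan r m K U p : (0 < r)%N -> near_turan e r m K U p ->
  (0 < #|U|)%N -> #|U|%:R / 4 <= l U ->
  l U <= (1 - r%:R^-1) * #|U|%:R + (64 * r * m * m)%:R / #|U|%:R.
Proof.
move=> r0 [[pr _ pint _] _] U0 lU; set k := #|U|%:R : R in lU *.
have k0 : 0 < k by rewrite ltr0n.
have l0 : 0 < l U by lra.
have [x [x01 [v xv] xE xU]] := perron_induced R e_sym n_gt0 U.
have {}xU := xU l0.
have xge w : 0 <= x w by have /andP[] := x01 w.
have xle w : x w <= 1 by have /andP[] := x01 w.
set N := \sum_u x u ^+ 2.
have N1 : 1 <= N := sum_sq_gt0 xv.
have NU : N = \sum_(u in U) x u ^+ 2.
  by apply: sum_supported => w /xU ->; rewrite expr0n.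
have lN : l U ^+ 2 <= k * N.
  apply: le_trans (_ : (\sum_(u in U) x u) ^+ 2 <= _).
    rewrite lerXn2r ?nnegrE ?sumr_ge0 //; first exact: ltW.
    rewrite -[l U]mulr1 -xv -xE [leRHS]big_mkcond; apply: ler_sum => w _.
    by rewrite /induced; case: (v \in U); case: (w \in U); case: (e v w); rewrite /= ?mul1r ?mul0r.
  by rewrite NU; apply: (sq_sum_le_card (fun u => u \in U) x).
have kN : k / 16 <= N.
  rewrite -(ler_pM2l k0); apply: le_trans lN.
  have : (k / 4) ^+ 2 <= l U ^+ 2 by rewrite lerXn2r ?nnegrE //; lra.
  by lra.
have form : l U * N <= (1 - r%:R^-1) * k * N + (4 * r * m * m)%:R.
  rewrite -(quad_eigen xE).
  apply: le_trans (_ : \sum_u \sum_v (p u != p v)%:R * x u * x v +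
    \sum_u \sum_v ([&& u \in U, v \in U, e u v & p v == p u])%:R <= _).
    rewrite -big_split; apply: ler_sum => u _; rewrite -big_split; apply: ler_sum => w _ /=.
    have xx0 : 0 <= x u * x w by apply: mulr_ge0.
    have xx1 : x u * x w <= 1 by apply: mulr_ile1.
    rewrite /induced -!mulrA eq_sym.
    by case: (u \in U); case: (w \in U); case: (e u w); case: (p w == p u);
      rewrite /= ?mul1r ?mul0r ?addr0 ?add0r.
  apply: lerD; first exact: multipartite_form_le.
  apply: le_trans (_ : (\sum_(v in U) #|nbrs e v :&: [set w in U | p w == p v]|)%:R <= _).
    rewrite natr_sum [leRHS]big_mkcond; apply: ler_sum => u _.
    case: ifP => uU; last by rewrite big1.
    rewrite -sum1_card natr_sum [leRHS]big_mkcond; apply: ler_sum => w _.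
    by rewrite !inE; case: (w \in U); case: (e u w); case: (p w == p u).
  by rewrite ler_nat.
have N0 : 0 < N by lra.
have {}form : l U <= (1 - r%:R^-1) * k + (4 * r * m * m)%:R / N.
  by rewrite -(ler_pM2r N0) mulrDl divfK ?gt_eqF.
apply: le_trans form _; rewrite lerD2l.
have -> : (64 * r * m * m)%:R / k = (4 * r * m * m)%:R / (k / 16).
  by rewrite !natrM; field; rewrite gt_eqF.
by apply: ler_wpM2l => //; rewrite lef_pV2 ?posrE //; lra.
Qed.
(** At l = th k the terms in d th k cancel and the main difference is th ((th k)^2 - d^2), of order
    eps k^2 since d is below th k by eps k. The remaining terms are either linear in k or carry the
    factor eps/16. *)
Lemma deletion_numeric (th eps c k l d : R) :
  1 / 2 <= th -> th <= 1 -> 0 < eps -> c = eps / 16 -> 24 <= eps * k -> 0 <= k ->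
  th * k - 1 <= l -> l <= k -> 0 <= d -> d <= (th - eps) * k ->
  d * (l + (th - c)) <= (th - c) * (l ^+ 2 + d * (k - d)).
Proof.
move=> th2 th1 eps0 -> ek k0 lk l_k d0 dk.
pose s := l - th * k; have s1 : -1 <= s by rewrite /s; lra.
have lE : l = th * k + s by rewrite /s; ring.
have d_th : d <= th * k.
  by apply: le_trans dk _; apply: ler_wpM2r => //; lra.
have dk1 : d <= k by apply: le_trans d_th _; rewrite -[leRHS]mul1r; apply: ler_wpM2r.
have eps_th : eps * k <= th * k - d by move: dk; rewrite mulrBl; lra.
have main : th * ((th * k) ^+ 2 - d ^+ 2) >= eps * k ^+ 2 / 4.
  have -> : (th * k) ^+ 2 - d ^+ 2 = (th * k - d) * (th * k + d) by ring.
  have thk2 : k / 2 <= th * k + d by nra.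
  have : (eps * k) * (k / 2) <= (th * k - d) * (th * k + d).
    by apply: ler_pM => //; [apply: mulr_ge0 => //; lra|lra].
  move: ((th * k - d) * (th * k + d)) => X hX.
  have X0 : 0 <= X by apply: le_trans hX; apply: mulr_ge0; lra.
  have : 1 / 2 * X <= th * X by apply: ler_wpM2r.
  have -> : eps * k ^+ 2 / 4 = (eps * k) * (k / 2) / 2 by field.
  by lra.
have key : (th - eps / 16) * (l ^+ 2 + d * (k - d)) - d * (l + (th - eps / 16)) =
  th * ((th * k) ^+ 2 - d ^+ 2) + s * (2 * th ^+ 2 * k - d) + th * s ^+ 2
   - th * d - eps / 16 * (l ^+ 2 + d * (k - d)) + d * (eps / 16).
  by rewrite lE; ring.
rewrite -subr_ge0 key.
have b1 : s * (2 * th ^+ 2 * k - d) >= - (2 * k).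
  have : 0 <= 2 * th ^+ 2 * k - d by nra.
  have : 2 * th ^+ 2 * k - d <= 2 * k by nra.
  by move: (2 * th ^+ 2 * k - d) => A; nra.
have b2 : th * d <= k by nra.
have b3 : l ^+ 2 + d * (k - d) <= 2 * k ^+ 2.
  have : l ^+ 2 <= k ^+ 2 by nra.
  by nra.
have b4 : 0 <= th * s ^+ 2 by apply: mulr_ge0; [lra|apply: sqr_ge0].
have b5 : 0 <= d * (eps / 16) by apply: mulr_ge0 => //; lra.
have b6 : eps / 16 * (l ^+ 2 + d * (k - d)) <= eps / 16 * (2 * k ^+ 2).
  by apply: ler_wpM2l => //; lra.
have b7 : 24 * k <= eps * k ^+ 2 by rewrite expr2 mulrA; apply: ler_wpM2r.
by lra.
Qed.

Lemma sum_sq_delete u (x : 'I_n -> R) :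
  \sum_w (if w == u then 0 else x w) ^+ 2 = \sum_w x w ^+ 2 - x u ^+ 2.
Proof.
rewrite [in RHS](bigD1 u) //= addrAC subrr add0r [LHS](bigD1 u) //= eqxx expr0n /= add0r.
by apply: eq_bigr => w /negbTE ->.
Qed.

Lemma quad_delete U u (x : 'I_n -> R) (y := fun w => if w == u then 0 else x w) :
  \sum_w \sum_z (induced e (U :\ u) w z)%:R * y w * y z =
  \sum_w \sum_z (induced e U w z)%:R * x w * x z
    - 2 * x u * \sum_z (induced e U u z)%:R * x z.
Proof.
set f := fun w z => (induced e U w z)%:R * x w * x z.
have fu : \sum_z f u z = x u * \sum_z (induced e U u z)%:R * x z.
  by rewrite mulr_sumr; apply: eq_bigr => z _; rewrite /f; ring.
have fsym w z : f w z = f z w by rewrite /f (induced_sym e_sym); ring.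
have fuu : f u u = 0 by rewrite /f /induced e_irr !andbF !mul0r.
have fu' : \sum_(w | w != u) f w u = \sum_z f u z.
  by rewrite [RHS](bigD1 u) //= fuu add0r; apply: eq_bigr => w _.
rewrite -mulrA -fu (bigD1 u) //= big1 ?add0r => [|z _]; last by rewrite /y eqxx mulr0 mul0r.
rewrite [X in _ = X - _](bigD1 u) //= -/f.
have -> : \sum_(w | w != u) \sum_z f w z =
    \sum_(w | w != u) \sum_(z | z != u) f w z + \sum_(w | w != u) f w u.
  by rewrite -big_split; apply: eq_bigr => w _; rewrite (bigD1 u) //= addrC.
rewrite fu'.
have -> : \sum_(i | i != u) \sum_z (induced e (U :\ u) i z)%:R * y i * y z =
    \sum_(w | w != u) \sum_(z | z != u) f w z.
  apply: eq_bigr => w wu; rewrite (bigD1 u) //= /y eqxx mulr0 add0r (negbTE wu).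
  by apply: eq_bigr => z zu; rewrite (negbTE zu) /f /induced !inE wu zu.
by ring.
Qed.

(* As the degree of v0 is low, the eigenvalue equation at v0 bounds the square
   of the smallest weight by (1 - c)/k times the squared norm; deleting such a
   vertex costs less than th. *)
Lemma deletion_step r E U v0 (th := 1 - r%:R^-1 : R) (eps := (r * E)%:R^-1 : R) :
  (2 <= r)%N -> (0 < E)%N -> v0 \in U ->
  (#|U| + #|U| %/ E < r * #|U :\: nbrs e v0|)%N ->
  24 <= eps * #|U|%:R -> th * #|U|%:R - 1 <= l U ->
  exists2 u, u \in U & l U - th + eps / 16 <= l (U :\ u).
Proof.
move=> r2 E0 v0U degv0 epsk lth; set k := #|U|%:R : R in epsk lth.
have rR : (2 : R) <= r%:R by rewrite (ler_nat _ 2 r).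
have rE0 : (0 : R) < (r * E)%:R by rewrite ltr0n muln_gt0 E0 andbT (ltn_trans _ r2).
have eps0 : 0 < eps by rewrite invr_gt0.
have rinv : 0 < (r%:R : R)^-1 <= 1 / 2.
  by rewrite invr_gt0 ltr0n (ltn_trans _ r2) //= mul1r lef_pV2 ?posrE ?ltr0n // (ltn_trans _ r2).
have [th2 th1] : 1 / 2 <= th /\ th <= 1 by rewrite /th; move: rinv => /andP[]; lra.
have k0 : 0 <= k by rewrite ler0n.
have eps1 : eps <= 1.
  by rewrite invf_le1 // ler1n -(ltr0n R).
have k24 : 24 <= k by apply: le_trans epsk _; rewrite -[leRHS]mul1r; apply: ler_wpM2r.
pose d := #|nbrs e v0 :&: U|%:R : R.
have dk : d <= (th - eps) * k.
  have dE : d + #|U :\: nbrs e v0|%:R = k.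
    by rewrite /d /k setIC -natrD cardsID.
  have : k + k / E%:R <= r%:R * #|U :\: nbrs e v0|%:R.
    rewrite -natrM; apply: le_trans (_ : (#|U| + (#|U| %/ E).+1)%:R <= _);
      last by rewrite ler_nat addnS.
    rewrite natrD lerD2l ler_pdivrMr ?ltr0n // -natrM ler_nat.
    by rewrite ltnW // ltn_ceil.
  move: dE; move: (#|U :\: nbrs e v0|%:R) => a dE h.
  have : k / r%:R + k / r%:R / E%:R <= a.
    rewrite -(ler_pM2l (_ : 0 < r%:R)); last by lra.
    have -> : r%:R * (k / r%:R + k / r%:R / E%:R) = k + k / E%:R; last by [].
    by field; rewrite ?pnatr_eq0 -?lt0n E0 (ltn_trans _ r2).
  have -> : (th - eps) * k = k - (k / r%:R + k / r%:R / E%:R); last by lra.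
  rewrite /th /eps natrM; field; rewrite ?pnatr_eq0 -?lt0n E0 (ltn_trans _ r2) //.
have d0 : 0 <= d by rewrite ler0n.
have lk : l U <= k by apply: radius_le_card.
have l0 : 0 < l U by nra.
have [x [x01 [v1 xv1] xE xU]] := perron_induced R e_sym n_gt0 U.
have {}xU := xU l0.
have xge w : 0 <= x w by have /andP[] := x01 w.
set N := \sum_u x u ^+ 2.
have N1 : 1 <= N := sum_sq_gt0 xv1.
have NU : N = \sum_(u in U) x u ^+ 2.
  by apply: sum_supported => w /xU ->; rewrite expr0n.
have [u uU umin] : exists2 u, u \in U & forall w, w \in U -> x u <= x w.
  pose u := [arg min_(w < v0 in U) x w]%O; exists u; rewrite /u; case: arg_minP => //.
set xi := x u in umin.
have xi0 : 0 <= xi by apply: xge.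
have lxi : l U ^+ 2 * xi ^+ 2 <= d * (N - (k - d) * xi ^+ 2).
  rewrite -exprMn; apply: le_trans (_ : (\sum_(w in nbrs e v0 :&: U) x w) ^+ 2 <= _).
    rewrite lerXn2r ?nnegrE ?sumr_ge0 ?mulr_ge0 //; try exact: ltW.
    apply: le_trans (_ : l U * x v0 <= _); first by apply: ler_wpM2l (umin _ v0U); apply: ltW.
    rewrite -xE [leRHS]big_mkcond; apply: ler_sum => w _; rewrite /induced !inE v0U.
    by case: (w \in U); case: (e v0 w); rewrite /= ?mul1r ?mul0r.
  apply: le_trans (sq_sum_le_card (fun w => w \in nbrs e v0 :&: U) x) _.
  apply: ler_wpM2l => //.
  have -> : N = \sum_(w in nbrs e v0 :&: U) x w ^+ 2 + \sum_(w in U :\: nbrs e v0) x w ^+ 2.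
    by rewrite NU (big_setID (nbrs e v0)) /= setIC.
  have : (k - d) * xi ^+ 2 <= \sum_(w in U :\: nbrs e v0) x w ^+ 2.
    have -> : k - d = #|U :\: nbrs e v0|%:R.
      by rewrite /d /k -(cardsID (nbrs e v0) U) natrD setIC; ring.
    rewrite mulr_natl -sumr_const; apply: ler_sum => w; rewrite inE => /andP[_ wU].
    by rewrite lerXn2r ?nnegrE // umin.
  by lra.
have numeric := deletion_numeric th2 th1 eps0 erefl epsk k0 lth lk d0 dk.
set c := eps / 16 in numeric *.
have c_le : c <= 1 / 16 by rewrite /c; lra.
(* Setting the weight at [u] to 0 leaves the form l N - 2 l xi^2 and the squared norm N - xi^2. This
   inequality rearranges the claim that their quotient is at least l - th + c. *)
have key : (l U + (th - c)) * xi ^+ 2 <= (th - c) * N.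
  have thc : 0 < th - c by lra.
  have [d_eq0|d_neq0] := eqVneq d 0.
    have -> : xi ^+ 2 = 0.
      apply/eqP; rewrite eq_le sqr_ge0 andbT.
      by move: lxi; rewrite d_eq0 mul0r pmulr_rle0 // exprn_gt0.
    by rewrite mulr0; apply: mulr_ge0; lra.
  have dp : 0 < d by rewrite lt_neqAle eq_sym d_neq0.
  rewrite -(ler_pM2l dp); apply: le_trans (_ : (th - c) * (l U ^+ 2 + d * (k - d)) * xi ^+ 2 <= _).
    by rewrite mulrA; apply: ler_wpM2r numeric; apply: sqr_ge0.
  rewrite -mulrA [leRHS]mulrCA; apply: ler_wpM2l; first exact: ltW.
  by move: lxi; rewrite mulrBr mulrDl mulrA; lra.
have NX : 0 < N - xi ^+ 2.
  have thc : 0 < th - c by lra.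
  have [x0|xn0] := eqVneq xi 0; first by rewrite x0 expr0n /=; lra.
  have xp : 0 < xi ^+ 2 by rewrite exprn_gt0 // lt_neqAle eq_sym xn0.
  rewrite -(pmulr_rgt0 _ thc) mulrBr.
  have : 0 < l U * xi ^+ 2 by apply: mulr_gt0.
  by move: key; rewrite mulrDl; lra.
exists u; first exact: uU.
have := rayleigh (R := R) (@induced_sym _ _ e_sym (U :\ u)) n_gt0 (fun w =>
  if w == u then 0 else x w).
rewrite quad_delete (quad_eigen xE) sum_sq_delete xE -/N -/xi => ray.
rewrite -(ler_pM2r NX); apply: le_trans ray.
rewrite -subr_ge0 (_ : _ - _ = (th - c) * N - (l U + (th - c)) * xi ^+ 2) ?subr_ge0 //.
by ring.
Qed.

End Deletion.

Lemma induced_setT (R : realType) n (e : rel 'I_n) :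
  rel_radius R (induced e setT) = rel_radius R e.
Proof.
rewrite rel_radius.unlock; congr spectral_radius; apply/matrixP => u v.
by rewrite !mxE /induced !inE.
Qed.

(** Each deletion lowers th |U| by th but the radius by at most th - c, so the surplus of the radius
    over th |U| grows by c. Since the radius never exceeds |U|, the process must stop while |U| is
    still at least c (n - 1). *)
Lemma deletion_process (R : realType) n (e : rel 'I_n) r E
    (th := 1 - r%:R^-1 : R) (eps := (r * E)%:R^-1 : R) (c := eps / 16) :
  symmetric e -> irreflexive e -> (0 < n)%N -> (2 <= r)%N -> (0 < E)%N ->
  24 <= eps * (c * (n%:R - 1)) ->
  forall U : {set 'I_n},
  th * #|U|%:R - c / 2 + c * (n%:R - #|U|%:R) <= rel_radius R (induced e U) ->
  exists U' : {set 'I_n},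
   [/\ th * #|U'|%:R - c / 2 + c * (n%:R - #|U'|%:R) <= rel_radius R (induced e U'),
       forall v, v \in U' -> (r * #|U' :\: nbrs e v| <= #|U'| + #|U'| %/ E)%N &
       c * (n%:R - 1) <= #|U'|%:R].
Proof.
move=> e_sym e_irr n0 r2 E0 n_large U.
have rE0 : (0 : R) < (r * E)%:R by rewrite ltr0n muln_gt0 E0 andbT (ltn_trans _ r2).
have eps0 : 0 < eps by rewrite invr_gt0.
have eps1 : eps <= 1 by rewrite invf_le1 // ler1n -(ltr0n R).
have c0 : 0 < c by rewrite /c; lra.
have c1 : c <= 1 / 16 by rewrite /c; lra.
have th2 : 1 / 2 <= th.
  suff : (r%:R : R)^-1 <= 1 / 2 by rewrite /th; lra.
  by rewrite mul1r lef_pV2 ?posrE ?ltr0n ?(ler_nat _ 2 r) // (ltn_trans _ r2).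
have [N] := ubnP #|U|; elim: N U => // N IH U cU lU.
have kU : c * (n%:R - 1) <= #|U|%:R.
  have := le_trans lU (radius_le_card R e_sym n0 U).
  move: (#|U|%:R) (ler0n R #|U|) => k k0 h.
  have : (1 / 2) * k <= th * k by apply: ler_wpM2r.
  have : c * k <= 1 / 16 * k by apply: ler_wpM2r.
  by move: h; rewrite !mulrBr mulr1; lra.
have [degU|] := boolP [forall v in U, r * #|U :\: nbrs e v| <= #|U| + #|U| %/ E]%N.
  by exists U; split=> //; apply/forall_inP.
rewrite negb_forall_in => /exists_inP[v vU]; rewrite -ltnNge => degv.
have [||u uU lu] := @deletion_step R n e e_sym e_irr n0 r E U v r2 E0 vU degv.
- by apply: le_trans n_large _; rewrite -/eps; apply: ler_wpM2l => //; apply: ltW.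
- apply: le_trans lU; rewrite -/th.
  have : 0 <= c * (n%:R - #|U|%:R).
    apply: mulr_ge0; first exact: ltW.
    by rewrite subr_ge0 ler_nat; apply: leq_trans (max_card _) _; rewrite card_ord.
  by lra.
rewrite -/th -/eps -/c in lu.
have cUu : (#|U|%:R : R) = #|U :\ u|%:R + 1 by rewrite (cardsD1 u U) uU natrD addrC.
apply: (IH (U :\ u)); first by rewrite -ltnS; apply: leq_trans cU; rewrite (cardsD1 u U) uU.
apply: le_trans lu; move: lU; rewrite cUu; move: (#|U :\ u|%:R) => k.
by move: (rel_radius _ _) => l; rewrite !mulrBr !mulrDr; lra.
Qed.

Theorem spectral_stability (R : realType) r m K :
  (2 <= r)%N -> (0 < m)%N -> (0 < K)%N -> exists (c : R) (n0 : nat), 0 < c /\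
  forall n (e : rel 'I_n), (n0 <= n)%N -> symmetric e -> irreflexive e ->
  ~ star_config e r m -> ~ match_config e r m ->
  (1 - r%:R^-1) * n%:R - c <= rel_radius R e ->
  exists p, near_turan e r m K setT p.
Proof.
move=> r2 m0 K0; have r0 : (0 < r)%N by apply: ltn_trans r2.
have [E [N0 [E0 stab]]] := stability r0 m0 K0.
pose eps := (r * E)%:R^-1 : R; pose c := eps / 16.
have rE0 : (0 : R) < (r * E)%:R by rewrite ltr0n muln_gt0 E0 r0.
have eps0 : 0 < eps by rewrite invr_gt0.
have eps1 : eps <= 1 by rewrite invf_le1 // ler1n -(ltr0n R).
have c0 : 0 < c by rewrite /c; lra.
have c1 : c <= 1 / 16 by rewrite /c; lra.
have [C C0 CE] : exists2 C : R, 0 <= C & forall k : R, (64 * r * m * m)%:R / k = C / k.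
  by exists (64 * r * m * m)%:R => //; apply: ler0n.
have cC : 0 <= 4 * C / c by rewrite !mulr_ge0 ?invr_ge0 // ltW.
have e24 : 0 <= 24 / eps by rewrite mulr_ge0 ?invr_ge0 // ltW.
have [X [X0 X_eps X_N0 X_C X5]] : exists X : R,
    [/\ 0 <= X, 24 / eps <= X, N0%:R <= X, 4 * C / c <= X & 5 <= X].
  have N0_ge0 : (0 : R) <= N0%:R := ler0n _ _.
  exists (24 / eps + N0%:R + 4 * C / c + 5).
  move: (24 / eps) (N0%:R) (4 * C / c) e24 N0_ge0 cC => a b d a0 b0 d0.
  by clear -a0 b0 d0; split; lra.
exists (c / 2), (Num.bound (X / c + 1)); split; first by rewrite divr_gt0.
move=> n e n_large e_sym e_irr nstar nmatch le.
have Xn : X <= c * (n%:R - 1).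
  rewrite mulrC -ler_pdivrMr // lerBrDr; apply/ltW.
  apply: lt_le_trans (_ : (Num.bound (X / c + 1))%:R <= _); last by rewrite ler_nat.
  by apply: archi_boundP; rewrite addr_ge0 // mulr_ge0 ?invr_ge0 // ltW.
have n0 : (0 < n)%N.
  rewrite lt0n; apply: contraTneq (le_trans X0 Xn) => ->.
  by rewrite sub0r mulrN1 oppr_ge0 -ltNge.
have [||U [lU degU cU]] := @deletion_process R n e r E e_sym e_irr n0 r2 E0 _ setT.
- by rewrite -/eps -/c [leRHS]mulrC -ler_pdivrMr //; apply: le_trans Xn.
- by rewrite induced_setT cardsT card_ord subrr mulr0 addr0 -/eps -/c.
rewrite -/eps -/c in lU cU.
have XU : X <= #|U|%:R := le_trans Xn cU.
have U5 : 5 <= (#|U|%:R : R) := le_trans X5 XU.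
have UN : (N0 <= #|U|)%N by rewrite -(ler_nat R); apply: le_trans XU.
have UC : 4 * C <= c * #|U|%:R.
  by rewrite [leRHS]mulrC -ler_pdivrMr //; apply: le_trans XU.
have [p pU] := stab _ e U e_sym e_irr nstar nmatch UN degU.
suff UT : U = setT by exists p; rewrite -UT.
apply/eqP; rewrite eqEcard subsetT cardsT card_ord /=.
(* Even one deletion leaves a surplus of at least c/2 over th |U|, whereas [radius_near_turan]
   permits only C/|U| <= c/4. *)
rewrite leqNgt; apply/negP => Un.
have th2 : 1 / 2 <= 1 - (r%:R : R)^-1.
  suff : (r%:R : R)^-1 <= 1 / 2 by lra.
  by rewrite mul1r lef_pV2 ?posrE ?ltr0n ?(ler_nat _ 2 r).
have Un' : (#|U|%:R : R) + 1 <= n%:R by rewrite natr1 ler_nat.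
have k0 : (0 : R) < #|U|%:R by lra.
have card_pos : (0 < #|U|)%N by rewrite -(ltr0n R).
have lin : c <= c * (n%:R - #|U|%:R).
  by rewrite -[leLHS]mulr1; apply: ler_wpM2l; [exact: ltW|lra].
have l4 : #|U|%:R / 4 <= rel_radius R (induced e U).
  apply: le_trans lU.
  have : 1 / 2 * #|U|%:R <= (1 - (r%:R : R)^-1) * #|U|%:R by apply: ler_wpM2r.
  by lra.
have := le_trans lU (radius_near_turan e_sym n0 r0 pU card_pos l4).
rewrite CE => h.
have : C / #|U|%:R <= c / 4.
  by rewrite ler_pdivrMr //; lra.
by lra.
Qed.

(** * Edge counts and moving vertices *)

Section Counting.
Variables (R : realType) (n : nat).
Implicit Types (e : rel 'I_n) (p : 'I_n -> nat).

Definition part_size p i : R := #|[set v | p v == i]|%:R.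

Lemma part_sizeE p i : part_size p i = \sum_(v | p v == i) 1.
Proof. by rewrite /part_size -sum1_card natr_sum; apply: eq_bigl => v; rewrite inE. Qed.

Lemma sum_parts p r (f : 'I_n -> R) : (forall v, (p v < r)%N) ->
  \sum_(i < r) \sum_(v | p v == i) f v = \sum_v f v.
Proof.
move=> pr; rewrite (exchange_big_dep predT) //=; apply: eq_bigr => v _.
rewrite (big_pred1 (Ordinal (pr v))) //.
Qed.

Lemma sum_part_size p r : (forall v, (p v < r)%N) -> \sum_(i < r) part_size p i = n%:R.
Proof.
move=> pr; under eq_bigr do rewrite part_sizeE.
by rewrite sum_parts // sumr_const card_ord.
Qed.

Lemma multipartite_count p r : (forall v, (p v < r)%N) ->
  \sum_u \sum_v (p u != p v)%:R = n%:R ^+ 2 - \sum_(i < r) part_size p i ^+ 2.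
Proof.
move=> pr; have := @multipartite_form R n p r (fun=> 1) (fun u _ => pr u).
rewrite sumr_const card_ord -mulr_natr mul1r => E.
under [in RHS]eq_bigr do rewrite part_sizeE; rewrite -E.
by apply: eq_bigr => u _; apply: eq_bigr => v _; rewrite !mulr1.
Qed.

Lemma sum_sq_deviation p r (q := n%:R / r%:R : R) : (0 < r)%N -> (forall v, (p v < r)%N) ->
  \sum_(i < r) part_size p i ^+ 2 =
  n%:R ^+ 2 / r%:R + \sum_(i < r) (part_size p i - q) ^+ 2.
Proof.
move=> r0 pr; have rn0 : r%:R != 0 :> R by rewrite pnatr_eq0 -lt0n.
have -> : \sum_(i < r) (part_size p i - q) ^+ 2 =
    \sum_(i < r) part_size p i ^+ 2 - 2 * q * \sum_(i < r) part_size p i + r%:R * q ^+ 2.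
  have -> : r%:R * q ^+ 2 = \sum_(i < r) q ^+ 2 by rewrite sumr_const card_ord mulr_natl.
  rewrite mulr_sumr -sumrB -big_split.
  by apply: eq_bigr => i _ /=; ring.
by rewrite sum_part_size // /q; field.
Qed.

Lemma handshakeR (G : sgraph n) :
  2 * (num_edges G)%:R = \sum_u \sum_v (adj G u v)%:R :> R.
Proof.
rewrite -natrM handshake natr_sum; apply: eq_bigr => u _.
by rewrite natr_sum.
Qed.

Lemma rho_ge_edges (G : sgraph n) : (0 < n)%N ->
  2 * (num_edges G)%:R <= rho R G * n%:R.
Proof.
move=> n0; have := rayleigh (R := R) (@adj_sym _ G) n0 (fun=> 1).
rewrite handshakeR rho_rel_radius expr1n sumr_const card_ord -mulr_natr mul1r.
by under eq_bigr do under eq_bigr do rewrite !mulr1.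
Qed.

Lemma card_residue_class r i : (i < r)%N ->
  (n %/ r <= #|[set v : 'I_n | v %% r == i]| <= (n %/ r).+1)%N.
Proof.
move=> ir; have r0 : (0 < r)%N by case: r ir.
apply/andP; split.
  have lt (j : 'I_(n %/ r)) : (j * r + i < n)%N.
    have := ltn_ord j; rewrite leq_divRL //; by move: (j : nat) => j'; nia.
  pose f j := Ordinal (lt j).
  have f_inj : injective f.
    move=> j k /(congr1 val) /= /eqP; rewrite eqn_add2r eqn_pmul2r // => /eqP.
    exact: val_inj.
  rewrite -[X in (X <= _)%N]card_ord -(card_imset predT f_inj); apply: subset_leq_card.
  by apply/subsetP => v /imsetP[j _ ->]; rewrite inE /= modnMDl modn_small.
have lt (v : 'I_n) : (v %/ r < (n %/ r).+1)%N by rewrite ltnS leq_div2r // ltnW.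
rewrite -[X in (_ <= X)%N]card_ord.
rewrite -(card_in_imset (f := fun v : 'I_n => Ordinal (lt v))) ?max_card //.
move=> v w; rewrite !inE => /eqP vi /eqP wi /(congr1 val) /= vw.
by apply: val_inj; rewrite /= (divn_eq v r) (divn_eq w r) vi wi vw.
Qed.

(** Each residue class has a size within 1 of n/r, so the squared deviations add up to at most
    [r]. *)
Lemma turan_edges_ge r : (0 < r)%N ->
  (1 - r%:R^-1) * n%:R ^+ 2 - r%:R <= 2 * (num_edges (turan_graph n r))%:R :> R.
Proof.
move=> r0; pose p (v : 'I_n) := (v %% r)%N.
have pr v : (p v < r)%N by rewrite ltn_pmod.
rewrite handshakeR.
have -> : \sum_u \sum_v (adj (turan_graph n r) u v)%:R = \sum_u \sum_v (p u != p v)%:R :> R.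
  by apply: eq_bigr => u _; apply: eq_bigr => v _; rewrite adj_turan.
rewrite (multipartite_count pr) (sum_sq_deviation r0 pr).
suff : \sum_(i < r) (part_size p i - n%:R / r%:R) ^+ 2 <= r%:R :> R.
  by rewrite mulrBl mul1r [r%:R^-1 * _]mulrC; lra.
apply: le_trans (_ : \sum_(i < r) 1 <= _); last by rewrite sumr_const card_ord.
apply: ler_sum => i _.
have /andP[h1 h2] := card_residue_class (ltn_ord i).
have rR : (0 : R) < r%:R by rewrite ltr0n.
have d1 : (n %/ r)%:R <= n%:R / r%:R :> R.
  by rewrite ler_pdivlMr // -natrM ler_nat leq_trunc_div.
have d2 : n%:R / r%:R <= (n %/ r).+1%:R :> R.
  by rewrite ler_pdivrMr // -natrM ler_nat ltnW // ltn_ceil.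
rewrite -natr1 in d2.
have {}h1 : (n %/ r)%:R <= part_size p i by rewrite ler_nat.
have {}h2 : part_size p i <= (n %/ r)%:R + 1 by rewrite natr1 ler_nat.
move: (part_size p i) (n%:R / r%:R) ((n %/ r)%:R) h1 h2 d1 d2 => a q f h1 h2 d1 d2.
have : 0 <= (1 - (a - q)) * (1 + (a - q)) by apply: mulr_ge0; lra.
have -> : (1 - (a - q)) * (1 + (a - q)) = 1 - (a - q) ^+ 2 by ring.
by lra.
Qed.

(** Here and in [missing] pairs are ordered, so for a graph both are twice a number of edges or of
    non-edges. *)
Definition internal e p : R := \sum_u \sum_v ((p u == p v) && e u v)%:R.
Definition missing e p : R := \sum_u \sum_v ((p u != p v) && ~~ e u v)%:R.

Lemma edges_defect (G : sgraph n) p r : (forall v, (p v < r)%N) ->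
  2 * (num_edges G)%:R = n%:R ^+ 2 - \sum_(i < r) part_size p i ^+ 2
     + internal (adj G) p - missing (adj G) p :> R.
Proof.
move=> pr; rewrite handshakeR -multipartite_count // /internal /missing.
rewrite -big_split -sumrB; apply: eq_bigr => u _ /=.
rewrite -big_split -sumrB; apply: eq_bigr => v _ /=.
by case: (p u == p v); case: (adj G u v); rewrite /= ?addr0 ?subr0 ?add0r ?subrr.
Qed.

(* Vertices outside this set have exactly the neighbours prescribed by the
   complete multipartite graph, so two of them in the same part are twins. *)
Definition touched e p : {set 'I_n} := [set v | [exists w, e v w != (p v != p w)]].

Lemma card_touched e p : #|touched e p|%:R <= internal e p + missing e p.
Proof.
rewrite /internal /missing -big_split -sum1_card natr_sum big_mkcond.
apply: ler_sum => v _; rewrite -big_split /=; case: ifP => [|_].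
  rewrite inE => /existsP[w vw]; rewrite (bigD1 w) //=.
  apply: ler_wpDr; first by apply: sumr_ge0 => u _; apply: addr_ge0.
  by move: vw; case: (e v w); case: (p v == p w) => //= _; rewrite ?addr0 ?add0r.
by apply: sumr_ge0 => u _; apply: addr_ge0.
Qed.

(** * Moving untouched vertices between parts *)

Section Move.
Variables (F : graph_family) (G : sgraph n) (p : 'I_n -> nat) (r m : nat).
Hypothesis F_bounded : order_bounded F m.
Hypothesis G_free : family_free F G.
Hypothesis pr : forall v, (p v < r)%N.
Local Notation Z := (touched (adj G) p).
Hypothesis untouched_large : forall i, (i < r)%N -> (m <= #|[set v | p v == i] :\: Z|)%N.

Lemma untouched_adj u v : u \notin Z -> adj G u v = (p u != p v).
Proof.
by rewrite inE negb_exists => /forallP/(_ v); rewrite negbK => /eqP.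
Qed.

Variables (M : {set 'I_n}) (j : nat).
Hypothesis M_untouched : [disjoint M & Z].
Hypothesis j_lt : (j < r)%N.
Let p' v := if v \in M then j else p v.
Let e' u v := if (u \in M) || (v \in M) then p' u != p' v else adj G u v.

Let e'_sym : symmetric e'.
Proof. by move=> u v; rewrite /e' orbC eq_sym adj_sym. Qed.

Let e'_irr : irreflexive e'.
Proof. by move=> u; rewrite /e' eqxx adj_irr if_same. Qed.

Let p'_lt v : (p' v < r)%N.
Proof. by rewrite /p'; case: ifP. Qed.

Let p'Z v : v \in Z -> p' v = p v.
Proof.
by move=> vZ; rewrite /p' ifN //; apply/negP => /(disjointFr M_untouched); rewrite vZ.
Qed.

Let e'_untouched u v : u \notin Z -> e' u v = (p' u != p' v).
Proof.
rewrite /e' => uZ; case: ifP => // /norP[uM vM].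
by rewrite untouched_adj // /p' (negbTE uM) (negbTE vM).
Qed.

Let e'_touched u v : u \in Z -> v \in Z -> e' u v = adj G u v.
Proof.
move=> uZ vZ; rewrite /e' ifN // negb_or; apply/andP; split; apply/negP.
  by move=> /(disjointFr M_untouched); rewrite uZ.
by move=> /(disjointFr M_untouched); rewrite vZ.
Qed.

(** A copy of a member after the move is pulled back to [G]: touched vertices stay, and an untouched
    one goes to an untouched vertex of [G] lying in the part it now occupies. Adjacency to an
    untouched vertex depends on parts only, and each part of [G] has [m] untouched vertices to
    choose from. *)
Lemma move_free : family_free F (graph_of_rel e').
Proof.
move=> k H FH [f [f_inj fH]]; apply: (G_free FH).
have km := F_bounded FH.
pose C y := [set v | p v == p' (f y)] :\: Z.
have Csize (y y' : 'I_k) : (y < size (enum (C y')))%N.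
  by rewrite -cardE; apply: leq_trans (untouched_large (p'_lt _)); apply: leq_trans km.
pose g y := if f y \in Z then f y else nth (f y) (enum (C y)) y.
have gC y : f y \notin Z -> g y \in C y.
  by move=> yZ; rewrite /g (negbTE yZ) -mem_enum mem_nth.
have gZ y : (g y \in Z) = (f y \in Z).
  have [yZ|yZ] := boolP (f y \in Z); first by rewrite /g yZ.
  by have := gC y yZ; rewrite in_setD => /andP[/negbTE].
have pg y : p (g y) = p' (f y).
  have [yZ|/gC] := boolP (f y \in Z); first by rewrite /g yZ p'Z.
  by rewrite in_setD inE => /andP[_ /eqP].
exists g; split=> [x y gxy|x y /fH].
  have ZE : (f x \in Z) = (f y \in Z) by rewrite -!gZ gxy.
  have pE : p' (f x) = p' (f y) by rewrite -!pg gxy.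
  move: gxy; rewrite /g ZE; case: ifP => _; first exact: f_inj.
  have := Csize y x; have := Csize x x; rewrite /C pE.
  move: (enum _) (enum_uniq ([set v | p v == p' (f y)] :\: Z)) => l ul lx ly.
  by rewrite (set_nth_default (f x) (f y) ly) => /eqP; rewrite nth_uniq // => /eqP/val_inj.
rewrite adj_graph_of_rel //.
have [xZ|xZ] := boolP (f x \in Z); last first.
  by rewrite e'_untouched // untouched_adj ?gZ // !pg.
have [yZ|yZ] := boolP (f y \in Z).
  by rewrite e'_touched // /g xZ yZ.
by rewrite e'_sym e'_untouched // adj_sym untouched_adj ?gZ // !pg.
Qed.

(** Pairs with an untouched end follow the complete multipartite rule before and after the move, and
    pairs of touched vertices do not change. The edge count thus varies as for the complete
    multipartite graphs. *)
Lemma move_edges : 2 * (num_edges (graph_of_rel e'))%:R =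
  2 * (num_edges G)%:R + \sum_(i < r) part_size p i ^+ 2 - \sum_(i < r) part_size p' i ^+ 2 :> R.
Proof.
have -> : 2 * (num_edges (graph_of_rel e'))%:R = \sum_u \sum_v (e' u v)%:R :> R.
  rewrite handshakeR; apply: eq_bigr => u _; apply: eq_bigr => v _.
  by rewrite adj_graph_of_rel.
have := multipartite_count pr; have := multipartite_count p'_lt.
suff : \sum_u \sum_v (e' u v)%:R + \sum_u \sum_v (p u != p v)%:R =
       \sum_u \sum_v (adj G u v)%:R + \sum_u \sum_v (p' u != p' v)%:R :> R.
  by rewrite handshakeR; lra.
rewrite -!big_split; apply: eq_bigr => u _; rewrite -!big_split; apply: eq_bigr => v _ /=.
have [uZ|uZ] := boolP (u \in Z); last by rewrite e'_untouched // untouched_adj // addrC.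
have [vZ|vZ] := boolP (v \in Z); first by rewrite e'_touched // !p'Z.
rewrite e'_sym e'_untouched // adj_sym untouched_adj // addrC.
by rewrite (eq_sym (p u)) (eq_sym (p' u)).
Qed.

Lemma move_sizes i : (i < r)%N -> i != j -> M \subset [set v | p v == i] ->
  \sum_(c < r) part_size p c ^+ 2 - \sum_(c < r) part_size p' c ^+ 2 =
  2 * #|M|%:R * (part_size p i - part_size p j - #|M|%:R).
Proof.
move=> ir ij Mi.
have Mp v : v \in M -> p v = i by move=> /(subsetP Mi); rewrite inE => /eqP.
have pi : part_size p' i = part_size p i - #|M|%:R.
  apply/eqP; rewrite eq_sym subr_eq /part_size -natrD eqr_nat.
  rewrite -(cardsID M [set v | p v == i]) (setIidPr Mi) addnC eqn_add2r; apply/eqP.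
  apply: eq_card => v; rewrite !inE /p'; case: ifP => //= _.
  by rewrite eq_sym (negbTE ij).
have pj : part_size p' j = part_size p j + #|M|%:R.
  rewrite /part_size -natrD; congr _%:R.
  rewrite -(cardsID M [set v | p' v == j]) addnC; congr (_ + _)%N.
    apply: eq_card => v; rewrite !inE /p'; case: ifP => //= vM.
    by rewrite (Mp v vM) (negbTE ij).
  by apply: eq_card => v; rewrite !inE /p'; case: ifP; rewrite ?eqxx ?andbF.
have pc c : c != i -> c != j -> part_size p' c = part_size p c.
  move=> ci cj; congr _%:R; apply: eq_card => v; rewrite !inE /p'; case: ifP => // vM.
  by rewrite (Mp v vM) eq_sym (negbTE cj) eq_sym (negbTE ci).
have split2 (f : nat -> R) : \sum_(c < r) f c =
    f i + f j + \sum_(c < r | (c != i :> nat) && (c != j :> nat)) f c.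
  rewrite (bigD1 (Ordinal ir)) //= (bigD1 (Ordinal j_lt)) /=; last first.
    by rewrite -val_eqE /= eq_sym.
  by rewrite addrA; congr (_ + _); apply: eq_bigl => c; rewrite -!val_eqE.
rewrite (split2 (fun c => part_size p c ^+ 2)) (split2 (fun c => part_size p' c ^+ 2)).
rewrite pi pj [X in _ - (_ + X)](eq_bigr (fun c : 'I_r => part_size p c ^+ 2)).
  by ring.
by move=> c /andP[ci cj]; rewrite pc.
Qed.

End Move.

End Counting.

(** * The Perron vector of an almost Turan graph *)

Section NearConstant.
Variables (R : realType) (n : nat) (e : rel 'I_n) (p : 'I_n -> nat) (r m K : nat).
Hypothesis r2 : (2 <= r)%N.
Hypothesis K0 : (0 < K)%N.
Hypothesis e_near : near_turan e r m K setT p.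

Local Notation th := (1 - r%:R^-1 : R).
Local Notation ka := (K%:R^-1 : R).
Local Notation n_ := (n%:R : R).

Lemma near_turan_lt v : (p v < r)%N.
Proof. by have [[pr _ _ _] _] := e_near; apply: pr; rewrite inE. Qed.

Let setT_part i : [set v in setT | p v == i] = [set v | p v == i].
Proof. by apply/setP => v; rewrite !inE. Qed.

Lemma near_turan_size i : (i < r)%N ->
  (1 - ka) * (n_ / r%:R) <= part_size R p i <= (1 + ka) * (n_ / r%:R).
Proof.
move=> ir; have [_ /(_ i ir)] := e_near; rewrite setT_part cardsT card_ord => -[h1 h2].
have rR : (0 : R) < r%:R by rewrite ltr0n (ltn_trans _ r2).
have KR : (0 : R) < K%:R by rewrite ltr0n.
rewrite -(ler_nat R) natrD !natrM -/(part_size R p i) in h1.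
rewrite -(ler_nat R) natrD !natrM -/(part_size R p i) in h2.
have Kr : 0 < K%:R * r%:R :> R by rewrite mulr_gt0.
have E1 : K%:R * r%:R * ((1 - ka) * (n_ / r%:R)) = K%:R * n_ - n_.
  by field; rewrite !gt_eqF.
have E2 : K%:R * r%:R * ((1 + ka) * (n_ / r%:R)) = K%:R * n_ + n_.
  by field; rewrite !gt_eqF.
by apply/andP; split; rewrite -(ler_pM2l Kr) ?E1 ?E2; lra.
Qed.

Lemma near_turan_internal : internal R e p <= (4 * r * m * m)%:R.
Proof.
have [[_ _ h _] _] := e_near; apply: le_trans (_ : (\sum_(v in setT) #|nbrs e v :&: [set w
  in setT | p w == p v]|)%:R <= _); last by rewrite ler_nat.
rewrite natr_sum /internal [leRHS]big_mkcond; apply: ler_sum => u _.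
rewrite inE -sum1_card natr_sum [leRHS]big_mkcond; apply: ler_sum => w _.
by rewrite !inE eq_sym; case: (e u w); case: (p w == p u).
Qed.

Variables (x : 'I_n -> R) (l : R) (u0 : 'I_n).
Hypothesis x01 : forall v, 0 <= x v <= 1.
Hypothesis xu0 : x u0 = 1.
Hypothesis xE : forall v, \sum_w (e v w)%:R * x w = l * x v.

Lemma eigen_le v : l * x v <= \sum_(w | p w != p v) x w + m%:R.
Proof.
have [[_ /(_ v (in_setT v)) h _ _] _] := e_near.
rewrite -xE (bigID (fun w => p w != p v)) /=; apply: lerD.
  apply: ler_sum => w _; have /andP[w0 _] := x01 w.
  by case: (e v w); rewrite ?mul1r ?mul0r.
apply: le_trans (_ : #|nbrs e v :&: [set w in setT | p w == p v]|%:R <= _).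
  rewrite -sum1_card natr_sum big_mkcond [leRHS]big_mkcond /=; apply: ler_sum => w _.
  have /andP[w0 w1] := x01 w; rewrite !inE negbK.
  by case: (e v w); case: (p w == p v); rewrite /= ?mul1r ?mul0r.
by rewrite ler_nat ltnW.
Qed.

Lemma eigen_ge v : \sum_(w | p w != p v) x w - ka * n_ <= l * x v.
Proof.
have [[_ _ _ /(_ v (in_setT v)) h] _] := e_near; rewrite cardsT card_ord in h.
have KR : (0 : R) < K%:R by rewrite ltr0n.
have hR : #|(setT :\: [set w in setT | p w == p v]) :\: nbrs e v|%:R <= ka * n_ :> R.
  by rewrite mulrC ler_pdivlMr // mulrC -natrM ler_nat.
suff : \sum_(w | p w != p v) x w <= l * x v +
    #|(setT :\: [set w in setT | p w == p v]) :\: nbrs e v|%:R by lra.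
rewrite -xE -sum1_card natr_sum big_mkcond [X in _ <= _ + X]big_mkcond -big_split /=.
apply: ler_sum => w _; have /andP[w0 w1] := x01 w; rewrite !inE.
by case: (e v w); case: (p w == p v); rewrite /= ?mul1r ?mul0r ?addr0 ?add0r.
Qed.

Hypothesis n_large : m%:R + 2 <= ka * n_.
Hypothesis ka_small : ka <= 1 / 100.
Hypothesis l_large : th * n_ - 1 <= l.

(** The equation at [u0], where x is 1, bounds the total deficiency (the sum of 1 - x w) outside its
    part by 2 ka n. A vertex of the same part sees almost the same neighbours as [u0], hence has
    deficiency at most 8 ka. The total is at most 10 ka n, so the equation at any [v] gives l (1 - x
    v) <= 14 ka n, and l >= n/4. *)
Lemma perron_near_constant v : 1 - 56 * ka <= x v.
Proof.
have rR : (0 : R) < r%:R by rewrite ltr0n (ltn_trans _ r2).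
have ka0 : 0 < ka by rewrite invr_gt0 ltr0n.
have rinv : 0 < (r%:R : R)^-1 <= 1 / 2.
  by rewrite invr_gt0 rR /= mul1r lef_pV2 ?posrE // (ler_nat _ 2 r).
have m_ge0 : 0 <= m%:R :> R by [].
have kan : 0 < ka * n_ by apply: lt_le_trans n_large; lra.
have n0 : 0 < n_ by rewrite -(pmulr_rgt0 _ ka0).
set q := n_ / r%:R; have thn : th * n_ = n_ - q by rewrite /q; ring.
have q0 : 0 <= q by rewrite mulr_ge0 // invr_ge0 ltW.
have qn : q <= n_ / 2.
  have /andP[_ h] := rinv; rewrite /q; have := ler_wpM2l (ltW n0) h; lra.
have cross j : \sum_(w | p w != j) (1 : R) = n_ - part_size R p j.
  rewrite part_sizeE; have : \sum_(w < n) (1 : R) = n_ by rewrite sumr_const card_ord.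
  by rewrite (bigID (fun w => p w == j)) /=; lra.
have crossI j : \sum_(w | p w != j) x w = n_ - part_size R p j - \sum_(w | p w != j) (1 - x w).
  by rewrite sumrB cross; ring.
have size j : (j < r)%N -> q - ka * n_ <= part_size R p j <= q + ka * n_.
  move=> jr; have /andP[h1 h2] := near_turan_size jr; rewrite -/q in h1 h2.
  have kq : ka * q <= ka * n_ by apply: ler_wpM2l; lra.
  by apply/andP; split; lra.
have x_ge0 w : 0 <= 1 - x w by have /andP[_] := x01 w; lra.
set i := p u0; have /andP[i1 i2] := size i (near_turan_lt u0).
have := eigen_le u0; rewrite xu0 mulr1 -/i => lu0.
have nl := n_large.
have kn100 : ka * n_ <= 1 / 100 * n_ by apply: ler_wpM2r => //; apply: ltW.
have ll := l_large; rewrite thn in ll.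
have l4 : n_ / 4 <= l by lra.
have l0 : 0 < l by lra.
have in_i w : p w = i -> 1 - x w <= 8 * ka.
  move=> wi; have := eigen_ge w; rewrite wi => h.
  have h1 : l * (1 - x w) <= 2 * (ka * n_) by rewrite mulrBr mulr1; lra.
  have h2 : n_ / 4 * (1 - x w) <= l * (1 - x w) by apply: ler_wpM2r.
  by rewrite -(ler_pM2l n0); lra.
have ub : l <= n_ - q + 2 * (ka * n_).
  have : 0 <= \sum_(w | p w != i) (1 - x w) by apply: sumr_ge0.
  by move: lu0; rewrite crossI; lra.
have out_i : \sum_(w | p w != i) (1 - x w) <= 2 * (ka * n_).
  by move: lu0; rewrite crossI; lra.
have all : \sum_w (1 - x w) <= 10 * (ka * n_).
  rewrite (bigID (fun w => p w != i)) /=.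
  have : \sum_(w | ~~ (p w != i)) (1 - x w) <= \sum_(w | ~~ (p w != i)) 8 * ka.
    by apply: ler_sum => w; rewrite negbK => /eqP; apply: in_i.
  have : \sum_(w | ~~ (p w != i)) 8 * ka <= 8 * (ka * n_).
    apply: le_trans (_ : \sum_(w < n) 8 * ka <= _).
      rewrite [leLHS]big_mkcond; apply: ler_sum => w _; case: ifP => // _.
      by lra.
    by rewrite sumr_const card_ord -mulr_natr; lra.
  by lra.
have out j : \sum_(w | p w != j) (1 - x w) <= 10 * (ka * n_).
  apply: le_trans all; rewrite [leRHS](bigID (fun w => p w != j)) /= lerDl.
  by apply: sumr_ge0.
have /andP[v1 v2] := size (p v) (near_turan_lt v).
have := eigen_ge v; rewrite crossI => h; have := out (p v) => hv.
have h1 : l * (1 - x v) <= 14 * (ka * n_) by rewrite mulrBr mulr1; lra.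
have h2 : n_ / 4 * (1 - x v) <= l * (1 - x v) by apply: ler_wpM2r.
suff : n_ * (1 - x v) <= n_ * (56 * ka) by rewrite ler_pM2l //; lra.
by lra.
Qed.

End NearConstant.

(** * Second order spectral bound for unbalanced parts *)

(** The factor 1 - ka absorbs the cubic remainder of the expansion. The quadratic term has to be
    kept because the linear ones cancel when summed over the parts. *)
Lemma inv_second_order (R : realFieldType) (s d ka : R) :
  0 < s -> `|d| <= ka * s -> ka <= 1 / 2 ->
  s^-1 - d / s ^+ 2 + (1 - ka) * (d ^+ 2 / s ^+ 3) <= (s + d)^-1.
Proof.
move=> s0 /[!ler_norml] /andP[d1 d2] ka2.
have sd : 0 < s + d.
  have : ka * s <= 1 / 2 * s by apply: ler_wpM2r => //; apply: ltW.
  by lra.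
have -> : s^-1 - d / s ^+ 2 + (1 - ka) * (d ^+ 2 / s ^+ 3) =
  (s ^+ 2 - s * d + (1 - ka) * d ^+ 2) / s ^+ 3 by field; rewrite gt_eqF.
rewrite ler_pdivrMr ?exprn_gt0 // ler_pdivlMl // -subr_ge0.
have -> : s ^+ 3 - (s + d) * (s ^+ 2 - s * d + (1 - ka) * d ^+ 2) =
  d ^+ 2 * (ka * s - (1 - ka) * d) by ring.
apply: mulr_ge0; first exact: sqr_ge0.
have [d0|d0] := lerP 0 d.
  have : (1 - ka) * d <= 1 * d; last by lra.
  apply: ler_wpM2r => //; suff : 0 <= ka by lra.
  by rewrite -(pmulr_lge0 _ s0); lra.
have : (1 - ka) * d <= 0 by rewrite pmulr_rle0; lra.
have : 0 <= ka * s by lra.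
by lra.
Qed.

(* The largest eigenvalue of a complete multipartite graph is the root of
   sum n_i / (la + n_i) = 1; this is the second order bound showing that the sum
   is at most 1 at la = th n - (th - 2 ka) Q / n. *)
Lemma sharp_numeric (R : realFieldType) (n q r th ka Q la : R) :
  0 < n -> 0 < r -> q = n / r -> th = 1 - r^-1 -> 1 / 2 <= th -> th <= 1 ->
  0 < ka -> ka <= 1 / 100 -> 0 <= Q -> Q <= ka ^+ 2 * n ^+ 2 ->
  la = th * n - (th - 2 * ka) * Q / n ->
  [/\ n / 4 <= la, n / 2 <= la + q, la + q <= n &
      r - la * (r / (la + q) + (1 - ka) * (Q / (la + q) ^+ 3)) <= 1].
Proof.
move=> n0 r0 qE thE th2 th1 ka0 ka1 Q0 Qn laE.
have [w wn] : exists w, w * n = (th - 2 * ka) * Q.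
  by exists ((th - 2 * ka) * Q / n); rewrite divfK // gt_eqF.
have {}laE : la = th * n - w by rewrite laE -wn mulfK // gt_eqF.
have w0 : 0 <= w.
  by rewrite -(pmulr_lge0 _ n0) wn mulr_ge0 //; lra.
have wkn : w <= ka ^+ 2 * n.
  rewrite -(ler_pM2r n0) wn -mulrA -expr2; apply: le_trans Qn.
  by rewrite -[leRHS]mul1r; apply: ler_wpM2r => //; lra.
have wn4 : w <= n / 10000.
  apply: le_trans wkn _; rewrite mulrC; apply: ler_wpM2l; first exact: ltW.
  have : ka * ka <= 1 / 100 * (1 / 100) by apply: ler_pM => //; exact: ltW.
  by rewrite expr2; lra.
have q0 : 0 < q by rewrite qE divr_gt0.
have thn : th * n = n - q by rewrite thE qE; field; rewrite gt_eqF.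
have th2n : n / 2 <= th * n by rewrite [leRHS]mulrC; apply: ler_wpM2l; lra.
have rq : r * q = n by rewrite qE; field; rewrite gt_eqF.
have [s sE] : exists s, s = n - w by eexists.
have laS : la = s - q by rewrite laE sE thn addrAC.
have s0 : 0 < s by rewrite sE; clear -wn4 n0; lra.
have sn : s <= n by rewrite sE; clear -w0; lra.
have -> : la + q = s by rewrite laS subrK.
split=> //.
- by rewrite laE; clear -wn4 th2n n0; lra.
- by rewrite sE; clear -wn4 n0; lra.
have -> : r - la * (r / s + (1 - ka) * (Q / s ^+ 3)) =
   (r * s ^+ 3 - la * (r * s ^+ 2 + (1 - ka) * Q)) / s ^+ 3 by field; rewrite gt_eqF.
rewrite ler_pdivrMr ?exprn_gt0 // mul1r -subr_ge0.
have -> : s ^+ 3 - (r * s ^+ 3 - la * (r * s ^+ 2 + (1 - ka) * Q)) =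
   s ^+ 2 * (s - n) + (1 - ka) * Q * la by rewrite laS -rq; ring.
have -> : s - n = - w by rewrite sE; ring.
rewrite -(pmulr_lge0 _ n0).
have -> : (s ^+ 2 * - w + (1 - ka) * Q * la) * n = (1 - ka) * Q * la * n - s ^+ 2 * (w * n) by ring.
rewrite wn.
have -> : (1 - ka) * Q * la * n - s ^+ 2 * ((th - 2 * ka) * Q) =
    Q * ((1 - ka) * (la * n) - (th - 2 * ka) * s ^+ 2) by ring.
apply: mulr_ge0 => //; rewrite subr_ge0.
have s2n : s ^+ 2 <= n ^+ 2 by rewrite lerXn2r ?nnegrE // ltW.
apply: le_trans (_ : (th - 2 * ka) * n ^+ 2 <= _).
  by apply: ler_wpM2l => //; clear -th2 ka1; lra.
apply: le_trans (_ : (1 - ka) * ((th * n - ka ^+ 2 * n) * n) <= _); last first.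
  apply: ler_wpM2l; first by clear -ka1; lra.
  by apply: ler_wpM2r; [exact: ltW|rewrite laE; clear -wkn; lra].
have -> : (1 - ka) * ((th * n - ka ^+ 2 * n) * n) = ((1 - ka) * (th - ka ^+ 2)) * n ^+ 2 by ring.
apply: ler_wpM2r; first exact: sqr_ge0.
have -> : (1 - ka) * (th - ka ^+ 2) = th - ka * (th + ka - ka ^+ 2) by ring.
have : ka * (th + ka - ka ^+ 2) <= ka * 2.
  apply: ler_wpM2l; first exact: ltW.
  by have := sqr_ge0 ka; clear -ka1 th1; lra.
by clear; lra.
Qed.

Section Sharp.
Variables (R : realType) (n : nat) (p : 'I_n -> nat) (r : nat) (ka : R).
Local Notation th := (1 - r%:R^-1 : R).
Local Notation n_ := (n%:R : R).
Local Notation q := (n_ / r%:R).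
Hypothesis r2 : (2 <= r)%N.
Hypothesis n0 : (0 < n)%N.
Hypothesis ka0 : 0 < ka.
Hypothesis ka1 : ka <= 1 / 100.
Hypothesis pr : forall v, (p v < r)%N.
Hypothesis p_size : forall i, (i < r)%N -> (1 - ka) * q <= part_size R p i <= (1 + ka) * q.

Definition imbalance := \sum_(i < r) (part_size R p i - q) ^+ 2.
Local Notation la := (th * n_ - (th - 2 * ka) * imbalance / n_).

Lemma imbalance_ge0 : 0 <= imbalance.
Proof. by apply: sumr_ge0 => i _; apply: sqr_ge0. Qed.

Lemma part_size_deviation i : (i < r)%N -> `|part_size R p i - q| <= ka * q.
Proof. by move=> /p_size/andP[h1 h2]; rewrite ler_norml; apply/andP; split; lra. Qed.

Lemma imbalance_le : imbalance <= ka ^+ 2 * n_ ^+ 2.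
Proof.
have rR : (0 : R) < r%:R by rewrite ltr0n (ltn_trans _ r2).
apply: le_trans (_ : \sum_(i < r) (ka * q) ^+ 2 <= _).
  apply: ler_sum => i _; rewrite -real_normK ?num_real // lerXn2r ?nnegrE //.
    by rewrite !mulr_ge0 ?invr_ge0 // ltW.
  exact: part_size_deviation.
rewrite sumr_const card_ord -[X in X <= _]mulr_natr.
have -> : (ka * q) ^+ 2 * r%:R = ka ^+ 2 * n_ ^+ 2 / r%:R by field; rewrite gt_eqF.
rewrite ler_pdivrMr //; apply: ler_peMr; first by rewrite mulr_ge0 ?sqr_ge0.
by rewrite ler1n (ltn_trans _ r2).
Qed.

(** Let S_i be the sum of y over part i. Cauchy-Schwarz with the weights n_i/(la + n_i), of total at
    most 1, bounds the square of the sum of the S_i by the sum of S_i^2 + la S_i^2/n_i. The first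
    terms cancel in the form, and S_i^2/n_i is at most the squared norm of y on part i. *)
Lemma multipartite_form_sharp (y : 'I_n -> R) :
  \sum_u \sum_v (p u != p v)%:R * y u * y v <= la * \sum_u y u ^+ 2.
Proof.
have rR : (0 : R) < r%:R by rewrite ltr0n (ltn_trans _ r2).
have nR : 0 < n_ by rewrite ltr0n.
have rinv : 0 < (r%:R : R)^-1 <= 1 / 2.
  by rewrite invr_gt0 rR /= mul1r lef_pV2 ?posrE // (ler_nat _ 2 r).
have th2 : 1 / 2 <= th by move: rinv => /andP[]; lra.
have th1 : th <= 1 by move: rinv => /andP[]; lra.
have kA := ka0; have kB := ka1.
have [la4 s2 sn num] := sharp_numeric nR rR erefl erefl th2 th1 ka0 ka1 imbalance_ge0
  imbalance_le erefl.
set l := la in la4 s2 sn num *.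
have q0 : 0 < q by rewrite divr_gt0.
have la0 : 0 < l by lra.
have s0 : 0 < l + q by lra.
have size0 i : (i < r)%N -> 0 < part_size R p i.
  by move=> /p_size/andP[h _]; apply: lt_le_trans h; rewrite mulr_gt0; lra.
rewrite (@multipartite_form R n p r) //.
have wsum : \sum_(i < r) part_size R p i / (l + part_size R p i) <= 1.
  apply: le_trans num.
  pose d (i : 'I_r) := part_size R p i - q.
  have qn : q <= n_ / 2.
    by have /andP[_ h] := rinv; have := ler_wpM2l (ltW nR) h; lra.
  apply: le_trans (_ : \sum_(i < r) (1 - l * ((l + q)^-1 - d i / (l + q) ^+ 2 +
      (1 - ka) * (d i ^+ 2 / (l + q) ^+ 3))) <= _).
    apply: ler_sum => i _; have s_pos := size0 i (ltn_ord i).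
    have -> : part_size R p i / (l + part_size R p i) = 1 - l * (l + part_size R p i)^-1.
      by field; rewrite gt_eqF //; lra.
    rewrite lerD2l lerN2; apply: ler_wpM2l; first exact: ltW.
    have -> : l + part_size R p i = (l + q) + d i by rewrite /d; ring.
    apply: inv_second_order => //; last by lra.
    apply: le_trans (part_size_deviation (ltn_ord i)) _.
    by apply: ler_wpM2l; lra.
  have dsum : \sum_i d i = 0.
    rewrite /d sumrB sum_part_size // sumr_const card_ord -[X in _ - X]mulr_natr.
    by field; rewrite gt_eqF.
  rewrite sumrB sumr_const card_ord -mulr_sumr big_split sumrB /= -mulr_suml dsum mul0r subr0.
  rewrite sumr_const card_ord -mulr_sumr -mulr_suml -[1 *+ r]/(r%:R).
  by rewrite -[_^-1 *+ r]mulr_natl lexx.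
have := @sq_sum_le R 'I_r predT (fun i => \sum_(u | p u == i) y u)
  (fun i => part_size R p i / (l + part_size R p i)) 1 _ wsum.
rewrite mul1r (sum_parts _ pr) => h.
have {}h := h (fun i _ => divr_gt0 (size0 i (ltn_ord i)) (addr_gt0 la0 (size0 i (ltn_ord i)))).
apply: le_trans (lerB h (lexx _)) _.
rewrite -sumrB mulr_sumr -(sum_parts (fun u => l * y u ^+ 2) pr); apply: ler_sum => i _.
have s_pos := size0 i (ltn_ord i).
rewrite -mulr_sumr; set S := \sum_(u | p u == i) y u.
have -> : S ^+ 2 / (part_size R p i / (l + part_size R p i)) - S ^+ 2 = l * (S ^+ 2 /
  part_size R p i).
  by field; rewrite !gt_eqF //; lra.
apply: ler_wpM2l; first exact: ltW.
rewrite ler_pdivrMr // mulrC.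
have := sq_sum_le_card (fun u => p u == i) y; rewrite /part_size cardsE; exact.
Qed.

End Sharp.

(** With weights in [1 - de, 1], an internal pair adds at most 1 to the form and a missing pair
    removes at least (1 - de)^2. The crude form bound, set against the lower bound on l, limits the
    missing pairs; the sharp form bound then gives the second estimate. *)
Lemma near_turan_radius_sharp (R : realType) n (e : rel 'I_n) (p : 'I_n -> nat) r m K
    (ka := K%:R^-1 : R) (th := 1 - r%:R^-1 : R) (l := rel_radius R e) :
  symmetric e -> (2 <= r)%N -> (0 < K)%N -> (r <= n)%N ->
  near_turan e r m K setT p ->
  m%:R + 2 <= ka * n%:R -> 56 * ka <= 1 / 8 ->
  th * n%:R ^+ 2 - r%:R <= l * n%:R ->
  missing R e p <= 4 * (internal R e p + r%:R) /\
  l * n%:R <= th * n%:R ^+ 2 - (th - 2 * ka) * imbalance R p r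
     + internal R e p - missing R e p + 224 * ka * (internal R e p + missing R e p).
Proof.
move=> e_sym r2 K0 rn near n_large ka_small l_large.
have n0 : (0 < n)%N by apply: leq_trans rn; apply: ltn_trans r2.
have nR : 0 < n%:R :> R by rewrite ltr0n.
have ka0 : 0 < ka by rewrite invr_gt0 ltr0n.
have ka1 : ka <= 1 / 100 by lra.
have pr := near_turan_lt near.
have [x [x01 [u0 xu0] xE]] := perron_vector R e_sym n0.
rewrite -/l in xE.
have l1 : th * n%:R - 1 <= l.
  rewrite -(ler_pM2r nR) mulrBl mul1r -mulrA -expr2; apply: le_trans l_large.
  by rewrite lerD2l lerN2 ler_nat.
have xde := perron_near_constant r2 K0 near x01 xu0 xE n_large ka1 l1.
have [de [deE de0 de8]] : exists de, [/\ de = 56 * ka, 0 < de & de <= 1 / 8].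
  by exists (56 * ka); split=> //; lra.
rewrite -/ka -deE in xde.
set a2 := internal R e p; set b2 := missing R e p.
have a0 : 0 <= a2 by apply: sumr_ge0 => u _; apply: sumr_ge0.
have b0 : 0 <= b2 by apply: sumr_ge0 => u _; apply: sumr_ge0.
have [N NE] : exists N, N = \sum_u x u ^+ 2 by eexists.
have N1 : N <= n%:R.
  rewrite NE; apply: le_trans (_ : \sum_(u < n) 1 <= _); last by rewrite sumr_const card_ord.
  by apply: ler_sum => u _; have /andP[? ?] := x01 u; rewrite exprn_ile1.
have N2 : (1 - de) ^+ 2 * n%:R <= N.
  rewrite NE; apply: le_trans (_ : \sum_(u < n) (1 - de) ^+ 2 <= _).
    by rewrite sumr_const card_ord mulr_natr.
  by apply: ler_sum => u _; rewrite lerXn2r ?nnegrE //; [lra|apply: le_trans (xde u); lra].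
have d2 : 1 - 2 * de <= (1 - de) ^+ 2 by rewrite sqrrB expr1n mul1r; have := sqr_ge0 de; lra.
have N0 : 0 < N.
  by apply: lt_le_trans N2; apply: mulr_gt0 => //; lra.
have form M : \sum_u \sum_v (p u != p v)%:R * x u * x v <= M * N ->
    l * N <= M * N + a2 - (1 - de) ^+ 2 * b2.
  move=> hM.
  suff : l * N + (1 - de) ^+ 2 * b2 <= \sum_u \sum_v (p u != p v)%:R * x u * x v + a2 by lra.
  rewrite {1}NE mulr_sumr /a2 /b2 /internal /missing mulr_sumr -!big_split;
    apply: ler_sum => u _ /=.
  have -> : l * x u ^+ 2 = x u * (l * x u) by ring.
  rewrite -xE !mulr_sumr -!big_split; apply: ler_sum => v _ /=.
  have /andP[xu_0 xu_1] := x01 u; have /andP[xv_0 xv_1] := x01 v.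
  have xx0 : 0 <= x u * x v by apply: mulr_ge0.
  have xx1 : x u * x v <= 1 by apply: mulr_ile1.
  have xxd : (1 - de) ^+ 2 <= x u * x v by rewrite expr2; apply: ler_pM; try apply: xde; lra.
  by case: (e u v); case: (p u == p v); rewrite /= ?mulr1 ?mulr0 ?mul1r ?mul0r ?mulr0 ?addr0 ?add0r.
have rR : (0 : R) < r%:R by rewrite ltr0n (ltn_trans _ r2).
have h1 : l * N <= th * n%:R * N + a2 - (1 - de) ^+ 2 * b2.
  apply: form; have := @multipartite_form_le R n setT p r x (ltn_trans (isT : 0 < 1)%N r2)
    (fun v _ => pr v).
  by rewrite cardsT card_ord NE; apply => v; rewrite inE.
have b_le : b2 <= 4 * (a2 + r%:R).
  have : (1 - de) ^+ 2 * b2 <= a2 + r%:R.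
    have : (th * n%:R - l) * N <= r%:R / n%:R * N.
      apply: ler_wpM2r; first exact: ltW.
      by rewrite ler_pdivlMr // mulrBl -mulrA -expr2; lra.
    have : r%:R / n%:R * N <= r%:R.
      by rewrite mulrAC ler_pdivrMr //; apply: ler_wpM2l => //; apply: ltW.
    by rewrite mulrBl; lra.
  have : 1 / 4 * b2 <= (1 - de) ^+ 2 * b2 by apply: ler_wpM2r => //; lra.
  by lra.
split=> //.
have sharp := @multipartite_form_sharp R n p r ka r2 n0 ka0 ka1 pr (@near_turan_size R n e
  p r m K r2 K0 near) x.
rewrite -NE in sharp; have {sharp} h2 := form _ sharp; rewrite -/th in h2.
set Q := imbalance R p r in h2 *.
set la := th * n%:R - _ in h2.
have nla : la * n%:R = th * n%:R ^+ 2 - (th - 2 * ka) * Q by rewrite /la; field; rewrite gt_eqF.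
have {}h2 : l <= la + (a2 - (1 - de) ^+ 2 * b2) / N.
  by rewrite -(ler_pM2r N0) mulrDl divfK ?gt_eqF // addrA.
have {}h2 : l * n%:R <= la * n%:R + (a2 - (1 - de) ^+ 2 * b2) * (n%:R / N).
  by have := ler_wpM2r (ltW nR) h2; rewrite mulrDl mulrA [_ / N * _]mulrAC.
rewrite -nla; suff : (a2 - (1 - de) ^+ 2 * b2) * (n%:R / N) <= a2 - b2 + 224 * ka * (a2 + b2).
  by move: h2; move: (la * _) (_ * (n%:R / N)) (224 * _ * _) => A B C; clear; lra.
have nu1 : 1 <= n%:R / N by rewrite ler_pdivlMr // mul1r.
(* Passing from the norm N to n costs this factor; with de = 56 ka it is the origin of 224 = 4 *
   56. *)
have nu2 : n%:R / N <= 1 + 4 * de.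
  rewrite ler_pdivrMr //; apply: le_trans (_ : (1 + 4 * de) * ((1 - de) ^+ 2 * n%:R) <= _);
    last first.
    by apply: ler_wpM2l => //; lra.
  rewrite mulrA -[leLHS]mul1r; apply: ler_wpM2r; first exact: ltW.
  have : 0 <= de * (2 - 7 * de + 4 * de ^+ 2).
    by apply: mulr_ge0; [lra|have := sqr_ge0 de; lra].
  have -> : (1 + 4 * de) * (1 - de) ^+ 2 = 1 + de * (2 - 7 * de + 4 * de ^+ 2) by ring.
  by lra.
have -> : 224 * ka = 4 * de by rewrite deE; ring.
move: (n%:R / N) nu1 nu2 => nu nu1 nu2; clearbody a2 b2.
have e1 : a2 * nu <= a2 * (1 + 4 * de) by apply: ler_wpM2l.
have e2 : (1 - 2 * de) * b2 <= (1 - de) ^+ 2 * b2 * nu.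
  apply: le_trans (_ : (1 - de) ^+ 2 * b2 <= _); first exact: ler_wpM2r.
  by rewrite ler_peMr // mulr_ge0 // sqr_ge0.
have e3 : 0 <= de * b2 by apply: mulr_ge0 => //; exact: ltW.
by rewrite mulrBl; lra.
Qed.

(** * The main theorem *)

Lemma turan_free F n r : (0 < r)%N ->
  is_family_chromatic_number F r.+1 -> family_free F (turan_graph n r).
Proof.
move=> r0 [_ chiF] k H FH [f [_ fH]].
have : colorable H r.
  apply/existsP; exists [ffun x => Ordinal (ltn_pmod (f x) r0)].
  apply/forallP => x; apply/forallP => y; apply/implyP => /fH.
  by rewrite adj_turan !ffunE; apply: contra => /eqP[->].
move=> Hr; have := chiF k H FH; rewrite /chromatic_number.
by case: ex_minnP => c _ /(_ r Hr) cr; rewrite ltnNge cr.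
Qed.

Lemma ex_attained n F (G0 : sgraph n) : family_free F G0 ->
  exists2 G : sgraph n, family_free F G & num_edges G = ex n F.
Proof.
move=> G0F; have P0 : (0 < #|[pred G : sgraph n | `[< family_free F G >]]|)%N.
  by apply/card_gt0P; exists G0; rewrite inE; apply/asboolP.
have [G /asboolP GF GE] := eq_bigmax_cond (fun G : sgraph n => num_edges G) P0.
by exists G.
Qed.

Lemma rho_le_spex (R : realType) n F (G : sgraph n) :
  family_free F G -> rho R G <= spex R n F.
Proof.
by move=> GF; apply: le_bigmax_seq; [exact: mem_index_enum|apply/asboolP].
Qed.

(** Squared deviations are smallest about the mean, so the mean may be replaced by the midpoint of
    the range, from which no size is further than half the gap. *)
Lemma imbalance_le_gap (R : realType) n (p : 'I_n -> nat) r (lo hi : R) :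
  (0 < r)%N -> (forall v, (p v < r)%N) ->
  (forall i, (i < r)%N -> lo <= part_size R p i <= hi) ->
  imbalance R p r <= r%:R * ((hi - lo) ^+ 2 / 4).
Proof.
move=> r0 pr lohi; rewrite /imbalance; set q := n%:R / r%:R.
have rn0 : r%:R != 0 :> R by rewrite pnatr_eq0 -lt0n.
pose c := (lo + hi) / 2.
have sumq : \sum_(i < r) (part_size R p i - q) = 0.
  rewrite sumrB sum_part_size // sumr_const card_ord -[X in _ - X]mulr_natr /q.
  by field.
apply: le_trans (_ : \sum_(i < r) (part_size R p i - c) ^+ 2 <= _).
  have -> : \sum_(i < r) (part_size R p i - c) ^+ 2 =
      \sum_(i < r) (part_size R p i - q) ^+ 2
      + 2 * (q - c) * \sum_(i < r) (part_size R p i - q) + \sum_(i < r) (q - c) ^+ 2.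
    by rewrite mulr_sumr -!big_split; apply: eq_bigr => i _ /=; ring.
  by rewrite sumq mulr0 addr0 lerDl; apply: sumr_ge0 => i _; apply: sqr_ge0.
apply: le_trans (_ : \sum_(i < r) (hi - lo) ^+ 2 / 4 <= _); last first.
  by rewrite sumr_const card_ord -[leLHS]mulr_natl.
apply: ler_sum => i _; have /andP[h1 h2] := lohi i (ltn_ord i).
rewrite /c; move: (part_size R p i) h1 h2 => s h1 h2.
have : 0 <= (hi - s) * (s - lo) by apply: mulr_ge0; lra.
suff -> : (s - (lo + hi) / 2) ^+ 2 = (hi - lo) ^+ 2 / 4 - (hi - s) * (s - lo) by lra.
by field.
Qed.

(** The product of the two halves is at least (g^2 - 1)/4, so the left side is at least 32 (g^2 -
    1), which exceeds 17 g^2 + 8 once g >= 2. *)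
Lemma balanced_of_gain (g : nat) :
  (64 * (2 * (g./2 * (g - g./2))) <= 17 * (g * g) + 8)%N -> (g <= 1)%N.
Proof.
have := odd_double_half g; rewrite -addnn.
by case: (odd g) => <- /=; move: g./2 => k; nia.
Qed.

Theorem theorem1p6 (R : realType) (r m : nat) (hr : (2 <= r)%N) :
  exists n0 : nat, forall n : nat, (n0 <= n)%N ->
    forall F : graph_family,
      order_bounded F m ->
      is_family_chromatic_number F r.+1 ->
      (ex n F < num_edges (turan_graph n r) + n %/ (2 * r))%N ->
      (SPEX R n F `<=` EX n F)%classic.
Proof.
have r0 : (0 < r)%N by apply: ltn_trans hr.
(* [Ca] bounds the internal pairs a, and [Ct] bounds a + b because b <= 4 (a + r). *)
have [Ca CaE] : exists Ca, (4 * r * m.+1 * m.+1)%N = Ca by eexists.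
have [Ct CtE] : exists Ct, Ct = (5 * Ca + 4 * r)%N by eexists.
(* As 1792 = 8 * 224, the error 224 ka (a + b) is at most 1/8. The bound 32 r makes 1 + 2 r ka at
   most 17/16, and 448 = 8 * 56 gives 56 ka <= 1/8. *)
have [K [K_Ct K_r K_448]] : exists K, [/\ 1792 * Ct <= K, 32 * r <= K & 448 <= K]%N.
  by exists (1792 * Ct + 32 * r + 448)%N; split; lia.
have K0 : (0 < K)%N by apply: leq_trans K_448.
have [c [n1 [c0 stab]]] := @spectral_stability R r m.+1 K hr (ltn0Sn m) K0.
exists (n1 + Num.bound (r%:R / c) + K * (m.+1 + 2) + 2 * r * (Ct + m.+1) + 2 * r)%N.
move=> n n_large F Fm chiF exF G [GF Grho]; split=> //.
have [n_n1 n_bound n_K n_C n_r] : [/\ (n1 <= n)%N, (Num.bound (r%:R / c) <= n)%N,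
    (K * (m.+1 + 2) <= n)%N, (2 * r * (Ct + m.+1) <= n)%N & (2 * r <= n)%N].
  by move: n_large; clear; split; lia.
have {}Fm : order_bounded F m.+1 by move=> k H /Fm/leqW.
have n0 : (0 < n)%N by apply: leq_trans n_r; rewrite muln_gt0.
have nR : 0 < n%:R :> R by rewrite ltr0n.
have rR : 0 < r%:R :> R by rewrite ltr0n.
have [no_star no_match] := free_no_configs r0 n_r Fm exF GF.
have TF := @turan_free F n r r0 chiF.
have [G' G'F G'ex] := ex_attained TF.
have rho_ex : 2 * (ex n F)%:R <= rho R G * n%:R.
  rewrite -G'ex; apply: le_trans (rho_ge_edges R G' n0) _.
  by apply: ler_wpM2r; rewrite ?Grho ?rho_le_spex // ltW.
have rho_T : (1 - r%:R^-1) * n%:R ^+ 2 - r%:R <= rho R G * n%:R.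
  apply: le_trans (turan_edges_ge R n r0) (le_trans _ rho_ex).
  by rewrite ler_wpM2l // ler_nat free_num_edges_le.
have [p near] : exists p, near_turan (adj G) r m.+1 K setT p.
  apply: stab => //; [exact: adj_sym|exact: adj_irr|].
  rewrite -rho_rel_radius -(ler_pM2r nR); apply: le_trans rho_T.
  rewrite mulrBl -mulrA -expr2 lerD2l lerN2.
  have rc : r%:R / c <= n%:R.
    apply: le_trans (_ : (Num.bound (r%:R / c))%:R <= _); last by rewrite ler_nat.
    by apply/ltW/archi_boundP; rewrite divr_ge0 // ltW.
  by rewrite mulrC -ler_pdivrMr.
have pr := near_turan_lt near.
set ka := K%:R^-1 : R.
have KR : 0 < K%:R :> R by rewrite ltr0n.
have ka0 : 0 < ka by rewrite invr_gt0.
have kaK (a : nat) : (a <= K)%N -> a%:R * ka <= 1.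
  by move=> aK; rewrite ler_pdivrMr // mul1r ler_nat.
have ka448 : 448%:R * ka <= 1 by apply: kaK.
have kaCt : (1792 * Ct)%:R * ka <= 1 by apply: kaK.
have kar : (32 * r)%:R * ka <= 1 by apply: kaK.
have m_ka : m.+1%:R + 2 <= ka * n%:R.
  by rewrite mulrC ler_pdivlMr // mulrC -(natrD R _ 2) -natrM ler_nat.
have [|||b_le upper] := @near_turan_radius_sharp R n (adj G) p r m.+1 K (@adj_sym _ G) hr
  K0 _ near m_ka.
- by apply: leq_trans n_r; rewrite mul2n -addnn leq_addr.
- by rewrite -/ka; lra.
- by rewrite -rho_rel_radius.
rewrite -rho_rel_radius in upper.
have a_le := near_turan_internal R near; rewrite CaE in a_le.
have Z_le := card_touched R (adj G) p.
have edgesG := edges_defect R G pr.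
rewrite (sum_sq_deviation R r0 pr) -/(imbalance R p r) in edgesG.
have size_ge i : (i < r)%N -> (Ct + m.+1 <= #|[set v | p v == i]|)%N.
  move=> ir; rewrite -(ler_nat R); have /andP[h _] := near_turan_size R hr K0 near ir.
  apply: le_trans h; rewrite -/ka.
  apply: le_trans (_ : 1 / 2 * (n%:R / r%:R) <= _); last first.
    by apply: ler_wpM2r; [rewrite divr_ge0|lra].
  have -> : 1 / 2 * (n%:R / r%:R) = n%:R / (2 * r)%:R :> R.
    by rewrite natrM; field; rewrite gt_eqF.
  by rewrite ler_pdivlMr ?ltr0n ?muln_gt0 // -natrM ler_nat mulnC.
move: a_le b_le upper Z_le edgesG.
move: (internal R (adj G) p) (missing R (adj G) p) => a2 b2 a_le b_le upper Z_le edgesG.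
have ab_le : a2 + b2 <= Ct%:R by rewrite CtE natrD !natrM; lra.
have Z_Ct : (#|touched (adj G) p| <= Ct)%N by rewrite -(ler_nat R); apply: le_trans ab_le.
have defect : 224 * ka * (a2 + b2) <= 1 / 8.
  apply: le_trans (_ : 224 * ka * Ct%:R <= _); first by apply: ler_wpM2l => //; lra.
  by move: kaCt; rewrite natrM; lra.
(* The edge count contains -Q and the spectral bound -(th - 2 ka) Q; their difference is the
   coefficient 1 - th + 2 ka = 1/r + 2 ka. *)
have gain : 2 * (ex n F)%:R <= 2 * (num_edges G)%:R + (r%:R^-1 + 2 * ka) * imbalance R p r + 1 / 8.
  by move: rho_ex upper; rewrite edgesG; move: (rho _ _ * _) => l; rewrite -/ka; lra.
pose c_ i := #|[set v | p v == i]|.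
pose i0 := [arg max_(i > Ordinal r0) c_ i]%N; pose j0 := [arg min_(i < Ordinal r0) c_ i]%N.
have i0P (i : 'I_r) : (c_ i <= c_ i0)%N by rewrite /i0; case: arg_maxnP => // k _; apply.
have j0P (i : 'I_r) : (c_ j0 <= c_ i)%N by rewrite /j0; case: arg_minnP => // k _; apply.
pose g := (c_ i0 - c_ j0)%N.
have gR : g%:R = part_size R p i0 - part_size R p j0 by rewrite natrB.
have Q_le : (r%:R^-1 + 2 * ka) * imbalance R p r <= 17 / 64 * g%:R ^+ 2.
  apply: le_trans (_ : (r%:R^-1 + 2 * ka) * (r%:R * (g%:R ^+ 2 / 4)) <= _).
    apply: ler_wpM2l; first by rewrite addr_ge0 ?invr_ge0 ?mulr_ge0 // ltW.
    rewrite gR; apply: imbalance_le_gap => // i ir.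
    by rewrite !ler_nat (i0P (Ordinal ir)) (j0P (Ordinal ir)).
  have -> : (r%:R^-1 + 2 * ka) * (r%:R * (g%:R ^+ 2 / 4)) =
      (1 + 2 * (r%:R * ka)) * (g%:R ^+ 2 / 4) by field; rewrite gt_eqF.
  have -> : 17 / 64 * g%:R ^+ 2 = 17 / 16 * (g%:R ^+ 2 / 4) :> R by field.
  apply: ler_wpM2r; first by rewrite divr_ge0 ?sqr_ge0.
  by move: kar; rewrite natrM; lra.
have g1 : (g <= 1)%N.
  have [ij|ij] := eqVneq (i0 : nat) j0; first by rewrite /g ij subnn.
  apply: balanced_of_gain; rewrite -(ler_nat R) natrD !natrM.
  pose P0 := [set v | p v == i0] :\: touched (adj G) p.
  pose M := take_set g./2 P0.
  have P_ge i : (i < r)%N -> (c_ i - Ct <= #|[set v | p v == i] :\: touched (adj G) p|)%N.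
    move=> ir; rewrite cardsD leq_sub2l //; apply: leq_trans Z_Ct.
    exact/subset_leq_card/subsetIr.
  (* The smallest part has at least [Ct] vertices, so removing the at most [Ct] touched ones from
     the largest part still leaves at least [g]. *)
  have cM : #|M| = g./2.
    apply: card_take_set; apply: leq_trans (P_ge i0 (ltn_ord i0)).
    have := size_ge j0 (ltn_ord j0); rewrite -/(c_ j0) /g => h.
    rewrite -divn2; apply: leq_trans (leq_div _ _) _; apply: leq_sub2l.
    by apply: leq_trans h; apply: leq_addr.
  have MP0 : M \subset P0 by apply: take_set_sub.
  have MZ : [disjoint M & touched (adj G) p].
    rewrite -setI_eq0 -subset0; apply/subsetP => v; rewrite inE => /andP[/(subsetP MP0)].
    by rewrite in_setD => /andP[/negbTE ->].
  have untouched i : (i < r)%N -> (m.+1 <= #|[set v | p v == i] :\: touched (adj G) p|)%N.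
    move=> ir; apply: leq_trans (P_ge i ir); have h := size_ge i ir.
    by rewrite leq_subRL //; apply: leq_trans h; apply: leq_addr.
  have free := @move_free n F G p r m.+1 Fm GF pr untouched M j0 MZ (ltn_ord j0).
  have := @move_edges R n G p r pr M j0 MZ (ltn_ord j0).
  have := @move_sizes R n p r M j0 (ltn_ord j0) i0 (ltn_ord i0) ij (subset_trans MP0
    (subsetDl _ _)).
  have := free_num_edges_le free; rewrite -(ler_nat R) -gR cM.
  have -> : (g - g./2)%:R = g%:R - g./2%:R :> R.
    by apply: natrB; rewrite -divn2 leq_div.
  move: gain Q_le; rewrite expr2.
  move: (num_edges (graph_of_rel _))%:R (num_edges G)%:R (ex n F)%:R.
  move: (\sum_(_ < r) _) (\sum_(_ < r) _) (g./2)%:R (g)%:R (_ * imbalance _ _ _).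
  by clear; move=> A B k g Q e' e x; lra.
(* With g <= 1 the bound reads 2 ex(n, F) <= 2 e(G) + 17/64 + 1/8, so the integer ex(n, F) is below
   e(G) + 1. *)
apply/eqP; rewrite eqn_leq free_num_edges_le //= -ltnS -(ltr_nat R) -natr1.
have : g%:R ^+ 2 <= 1 :> R.
  by rewrite expr_le1 // (ler_nat R g 1).
by move: gain Q_le; lra.
Qed.
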